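(* Let $M$ be a closed oriented surface immersed in the group $\mathrm{Nil}$, with mean curvature $H$ and induced area measure $d\mu$. Then its energy equals $$E(M)=\frac14\int_M\left(H^2+\frac{\widehat K}4-\frac1{16}\right)d\mu,$$ where $\widehat K$ at a point is the sectional curvature, in $\mathrm{Nil}$, of the tangent plane to the surface at that point.
   Context: $\mathrm{Nil}$ is the Heisenberg group of real upper triangular unipotent $3\times3$ matrices $\begin{pmatrix}1&x&z\\0&1&y\\0&0&1\end{pmatrix}$ with the left-invariant metric $dx^2+dy^2+(dz-x\,dy)^2$. The elements $e_1=E_{12}$, $e_2=E_{23}$, $e_3=E_{13}$ of its Lie algebra form a positively oriented orthonormal basis, with $[e_1,e_2]=e_3$, $[e_1,e_3]=[e_2,e_3]=0$. $\nabla$ is the Levi-Civita connection. Let $f:M\to\mathrm{Nil}$ be the immersion, $z=x+iy$ a local conformal parameter compatible with the orientation, and $e^{2\alpha}dz\,d\bar z$ the induced metric, so $d\mu=e^{2\alpha}dx\wedge dy$. Write $f^{-1}f_z=\sum_{k=1}^3Z_ke_k$ (left translation to the Lie algebra). The generating spinor $\psi=(\psi_1,\psi_2)^{\top}$ (defined locally up to a common sign) is a smooth function with $$Z_1=\tfrac i2(\bar\psi_2^2+\psi_1^2),\quad Z_2=\tfrac12(\bar\psi_2^2-\psi_1^2),\quad Z_3=\psi_1\bar\psi_2,$$ so $e^\alpha=|\psi_1|^2+|\psi_2|^2$. The unit normal $N$ is given by $$f^{-1}(N)=2ie^{-2\alpha}\left[(\bar Z_2Z_3-Z_2\bar Z_3)e_1+(\bar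 Z_3Z_1-Z_3\bar Z_1)e_2+(\bar Z_1Z_2-Z_1\bar Z_2)e_3\right]$$ and the mean curvature $H$ by $\nabla_{f_{\bar z}}f_z=\frac12e^{2\alpha}HN$. The spinor satisfies $\bar\partial\psi_1=V\psi_2$, $\partial\psi_2=-U\psi_1$ with potentials $$U=V=\frac H2\left(|\psi_1|^2+|\psi_2|^2\right)+\frac i4\left(|\psi_2|^2-|\psi_1|^2\right).$$ The form $UV\,dz\wedge d\bar z$ is a globally well-defined $2$-form on $M$, and the energy is $$E(M)=\int_MUV\,\frac{i\,dz\wedge d\bar z}2 .$$ *)

(* Defs.v *)
From HB Require Import structures.
From mathcomp Require Import all_boot all_order all_algebra.
From mathcomp Require Import complex.
From mathcomp Require Import all_classical all_reals all_analysis.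

Set Implicit Arguments.
Unset Strict Implicit.
Unset Printing Implicit Defensive.

Import Order.TTheory GRing.Theory Num.Theory.
Import numFieldNormedType.Exports.

Local Open Scope classical_set_scope.
Local Open Scope ring_scope.
Local Open Scope complex_scope.

Notation plane R := (R * R)%type.
Notation lebesgue2 := (lebesgue_measure \x lebesgue_measure)%E.

Section Plane.
Context {R : realType}.
Implicit Types (D : set (plane R)) (q v : plane R).

Definition ex : plane R := (1, 0).
Definition ey : plane R := (0, 1).

(* Meant for open [D]. *)
Fixpoint Ck (k : nat) D (h : plane R -> R) : Prop :=
  (forall q, D q -> {for q, continuous h}) /\
  match k with
  | 0%N => True
  | k'.+1 => (forall q, D q -> derivable h q ex /\ derivable h q ey) /\
             Ck k' D ('D_ex h) /\ Ck k' D ('D_ey h)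
  end.

Definition smooth_on D (h : plane R -> R) : Prop := forall k, Ck k D h.

Definition csmooth_on D (h : plane R -> R[i]) : Prop :=
  smooth_on D (fun q => complex.Re (h q)) /\
  smooth_on D (fun q => complex.Im (h q)).

Definition cderive v (h : plane R -> R[i]) q : R[i] :=
  'D_v (fun p => complex.Re (h p)) q +i* 'D_v (fun p => complex.Im (h p)) q.

(* With [z = x + i y]: d/dz = (d/dx - i d/dy)/2, d/dzbar = (d/dx + i d/dy)/2. *)
Definition dz (h : plane R -> R[i]) q : R[i] :=
  (cderive ex h q - 'i * cderive ey h q) / 2.
Definition dzbar (h : plane R -> R[i]) q : R[i] :=
  (cderive ex h q + 'i * cderive ey h q) / 2.

(* The integral of [h dx /\ dy], where dx /\ dy = (i/2) dz /\ dzbar. *)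
Definition cintegral D (h : plane R -> R[i]) : R[i] :=
  (\int[lebesgue2]_(q in D) complex.Re (h q)) +i*
  (\int[lebesgue2]_(q in D) complex.Im (h q)).

End Plane.

(* Levi-Civita connection and curvature of a metric [g] on R^3, in the standard
   coordinates; [g p i j] = g_{ij}(p). *)
Section Riemann3.
Context {R : realType}.
Variable g : 'rV[R]_3 -> 'M[R]_3.
Implicit Types (p u v w : 'rV[R]_3) (i j k l : 'I_3).

Definition pd i (h : 'rV[R]_3 -> R) p : R := 'D_(delta_mx 0 i) h p.

Definition metric p v w : R := \sum_i \sum_j g p i j * v 0 i * w 0 j.

(* [christoffel k i j] is Gamma^k_{ij}: nabla_{d_i} d_j = Gamma^k_{ij} d_k. *)
Definition christoffel k i j p : R :=
  2^-1 * \sum_l invmx (g p) k l *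
    (pd i (fun p' => g p' j l) p + pd j (fun p' => g p' i l) p
     - pd l (fun p' => g p' i j) p).

(* R(d_i, d_j) d_k = [riemann l i j k] d_l, where
   R(X, Y) = [nabla_X, nabla_Y] - nabla_[X, Y]. *)
Definition riemann l i j k p : R :=
  pd i (christoffel l j k) p - pd j (christoffel l i k) p
  + \sum_m (christoffel l i m p * christoffel m j k p
            - christoffel l j m p * christoffel m i k p).

Definition curvature p u v w : 'rV[R]_3 :=
  \row_l \sum_i \sum_j \sum_k riemann l i j k p * u 0 i * v 0 j * w 0 k.

Definition sectional p v w : R :=
  metric p (curvature p v w w) v /
  (metric p v v * metric p w w - metric p v w ^+ 2).

End Riemann3.

(* A point is the row (x, y, z); the corresponding group element is
   [nil_mx (x, y, z)]. *)
Section NilGroup.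
Context {K : comUnitRingType}.
Implicit Types (p v w : 'rV[K]_3) (A : 'M[K]_3) (k : 'I_3).

(* The basis e_1 = E_12, e_2 = E_23, e_3 = E_13, with indices from 0. *)
Definition nil_i k : 'I_3 := if k == 1 then 1 else 0.
Definition nil_j k : 'I_3 := if k == 0 then 1 else 2.
Definition nil_basis k : 'M[K]_3 := delta_mx (nil_i k) (nil_j k).

Definition nil_lie v : 'M[K]_3 := \sum_k v 0 k *: nil_basis k.
Definition nil_coord A : 'rV[K]_3 := \row_k A (nil_i k) (nil_j k).

Definition nil_mx p : 'M[K]_3 := 1%:M + nil_lie p.

(* Components in (e_1, e_2, e_3) of p^-1 w, for [w] tangent at [p] given by its
   coordinate components (dx, dy, dz); and the inverse operation. *)
Definition left_to_lie p w : 'rV[K]_3 :=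
  nil_coord (invmx (nil_mx p) *m nil_lie w).
Definition left_from_lie p v : 'rV[K]_3 :=
  nil_coord (nil_mx p *m nil_lie v).

End NilGroup.

Section NilMetric.
Context {R : realType}.
Implicit Types (p v w : 'rV[R]_3).

(* dx^2 + dy^2 + (dz - x dy)^2, polarized. *)
Definition nil_form p v w : R :=
  v 0 0 * w 0 0 + v 0 1 * w 0 1 +
  (v 0 2 - p 0 0 * v 0 1) * (w 0 2 - p 0 0 * w 0 1).

Definition nil_g p : 'M[R]_3 :=
  \matrix_(i, j) nil_form p (delta_mx 0 i) (delta_mx 0 j).

End NilMetric.

Record chart (R : realType) (M : topologicalType) := Chart {
  chart_dom : set M;
  chart_map : M -> plane R;
  chart_inv : plane R -> M;
  chart_im := chart_map @` chart_dom;
  chart_dom_open : open chart_dom;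
  chart_im_open : open chart_im;
  chart_mapK : forall p, chart_dom p -> chart_inv (chart_map p) = p;
  chart_map_cont : forall p, chart_dom p -> {for p, continuous chart_map};
  chart_inv_cont : forall q, chart_im q -> {for q, continuous chart_inv}
}.

Section Transition.
Context {R : realType} {M : topologicalType}.
Implicit Types c : chart R M.

Definition trans_dom c c' : set (plane R) :=
  chart_map c @` (chart_dom c `&` chart_dom c').
Definition trans1 c c' (q : plane R) : R := (chart_map c' (chart_inv c q)).1.
Definition trans2 c c' (q : plane R) : R := (chart_map c' (chart_inv c q)).2.

Definition oriented_transition c c' : Prop :=
  [/\ smooth_on (trans_dom c c') (trans1 c c'),
      smooth_on (trans_dom c c') (trans2 c c') &
      forall q, trans_dom c c' q ->
        0 < 'D_ex (trans1 c c') q * 'D_ey (trans2 c c') q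
            - 'D_ey (trans1 c c') q * 'D_ex (trans2 c c') q].

End Transition.

(* The base point carried by [ptopologicalType] plays no role beyond making the
   Borel sigma-algebra available.  Second countability follows from
   compactness. *)
Record closed_oriented_surface (R : realType) := ClosedOrientedSurface {
  surface_sort :> ptopologicalType;
  surface_compact : compact [set: surface_sort];
  surface_hausdorff : hausdorff_space surface_sort;
  surface_atlas : set (chart R surface_sort);
  surface_cover : forall p, exists2 c, surface_atlas c & chart_dom c p;
  surface_oriented : forall c c', surface_atlas c -> surface_atlas c' ->
    oriented_transition c c'
}.

Definition borel (T : ptopologicalType) := g_sigma_algebraType (@open T).

Section Immersion.
Context {R : realType} {M : closed_oriented_surface R}.
Implicit Types (f : M -> 'rV[R]_3) (c : chart R M) (H Khat : M -> R)
  (q v w : plane R).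

(* Charts belonging to the maximal oriented smooth atlas. *)
Definition oriented_chart c : Prop :=
  forall a, surface_atlas a ->
    oriented_transition a c /\ oriented_transition c a.

Definition local_map f c q : 'rV[R]_3 := f (chart_inv c q).

Definition local_derive v f c q : 'rV[R]_3 :=
  \row_k 'D_v (fun q' => local_map f c q' 0 k) q.

Definition immersion f : Prop :=
  forall c, surface_atlas c ->
    (forall k, smooth_on (chart_im c) (fun q => local_map f c q 0 k)) /\
    (forall q, chart_im c q -> forall a b : R,
      a *: local_derive ex f c q + b *: local_derive ey f c q = 0 ->
      a = 0 /\ b = 0).

Definition induced_form f c q v w : R :=
  metric nil_g (local_map f c q)
    (local_derive v f c q) (local_derive w f c q).

(* I.e. the coordinate of [c] is a conformal parameter compatible with the
   orientation; the induced metric is e^(2 alpha) |dz|^2, where e^(2 alpha)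
   is [conformal_factor]. *)
Definition conformal_parameter f c : Prop :=
  oriented_chart c /\
  forall q, chart_im c q ->
    induced_form f c q ex ex = induced_form f c q ey ey /\
    induced_form f c q ex ey = 0.

Definition conformal_factor f c q : R := induced_form f c q ex ex.

Definition is_area_measure f (mu : {measure set (borel M) -> \bar R}) : Prop :=
  forall c, conformal_parameter f c ->
  forall A : set M, measurable (A : set (borel M)) -> A `<=` chart_dom c ->
    mu A = (\int[lebesgue2]_(q in chart_map c @` A)
              (conformal_factor f c q)%:E)%E.

Definition clocal_map f c q : 'rV[R[i]]_3 :=
  map_mx (real_complex R) (local_map f c q).

Definition f_z f c q : 'rV[R[i]]_3 :=
  \row_k dz (fun q' => clocal_map f c q' 0 k) q.
Definition f_zbar f c q : 'rV[R[i]]_3 :=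
  \row_k dzbar (fun q' => clocal_map f c q' 0 k) q.

(* f^-1 f_z = Z_1 e_1 + Z_2 e_2 + Z_3 e_3 *)
Definition Zvec f c q : 'rV[R[i]]_3 :=
  left_to_lie (clocal_map f c q) (f_z f c q).

Definition normal_lie f c q : 'rV[R[i]]_3 :=
  let Z := Zvec f c q 0 in
  (2 * 'i * ((conformal_factor f c q)^-1)%:C) *:
  \row_k (if k == 0 then (Z 1)^* * Z 2 - Z 1 * (Z 2)^*
          else if k == 1 then (Z 2)^* * Z 0 - Z 2 * (Z 0)^*
          else (Z 0)^* * Z 1 - Z 0 * (Z 1)^*).

Definition unit_normal f c q : 'rV[R[i]]_3 :=
  left_from_lie (clocal_map f c q) (normal_lie f c q).

(* nabla_{f_zbar} f_z, for the Levi-Civita connection of Nil along f, extended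
   complex-linearly; components in the coordinates (x, y, z), as for
   [unit_normal]. *)
Definition nabla_zbar_z f c q : 'rV[R[i]]_3 :=
  \row_k (dzbar (fun q' => f_z f c q' 0 k) q +
    \sum_i \sum_j (christoffel nil_g k i j (local_map f c q))%:C *
      f_zbar f c q 0 i * f_z f c q 0 j).

Definition is_mean_curvature f H : Prop :=
  forall c, conformal_parameter f c -> forall q, chart_im c q ->
    nabla_zbar_z f c q =
    (2^-1 * conformal_factor f c q * H (chart_inv c q))%:C *: unit_normal f c q.

Definition is_tangent_sectional_curvature f Khat : Prop :=
  forall c, surface_atlas c -> forall q, chart_im c q ->
    Khat (chart_inv c q) =
    sectional nil_g (local_map f c q)
      (local_derive ex f c q) (local_derive ey f c q).

Definition generating_spinor f c (psi1 psi2 : plane R -> R[i]) : Prop :=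
  [/\ csmooth_on (chart_im c) psi1, csmooth_on (chart_im c) psi2 &
      forall q, chart_im c q ->
        [/\ Zvec f c q 0 0 = 'i / 2 * ((psi2 q)^* ^+ 2 + psi1 q ^+ 2),
            Zvec f c q 0 1 = 2^-1 * ((psi2 q)^* ^+ 2 - psi1 q ^+ 2) &
            Zvec f c q 0 2 = psi1 q * (psi2 q)^*]].

(* U = V as a function of H and of the values of the spinor. *)
Definition potential (h : R) (s1 s2 : R[i]) : R[i] :=
  (h / 2)%:C * (`|s1| ^+ 2 + `|s2| ^+ 2) +
  'i / 4 * (`|s2| ^+ 2 - `|s1| ^+ 2).

Definition potentialU H c (psi1 psi2 : plane R -> R[i]) q : R[i] :=
  potential (H (chart_inv c q)) (psi1 q) (psi2 q).
Definition potentialV H c (psi1 psi2 : plane R -> R[i]) q : R[i] :=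
  potential (H (chart_inv c q)) (psi1 q) (psi2 q).

(* A finite partition of M into Borel pieces, each inside the domain of a
   conformal parameter that carries a generating spinor; a globally defined
   2-form is integrated over M by summing its integrals over the pieces, each
   computed in its own parameter. *)
Record spinor_partition f := SpinorPartition {
  sp_size : nat;
  sp_chart : 'I_sp_size -> chart R M;
  sp_psi1 : 'I_sp_size -> plane R -> R[i];
  sp_psi2 : 'I_sp_size -> plane R -> R[i];
  sp_piece : 'I_sp_size -> set M;
  sp_conformal : forall i, conformal_parameter f (sp_chart i);
  sp_spinor : forall i,
    generating_spinor f (sp_chart i) (sp_psi1 i) (sp_psi2 i);
  sp_borel : forall i, measurable (sp_piece i : set (borel M));
  sp_sub : forall i, sp_piece i `<=` chart_dom (sp_chart i);
  sp_disjoint : trivIset [set: 'I_sp_size] sp_piece;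
  sp_cover : \bigcup_i sp_piece i = [set: M]
}.

Definition energy f H (P : spinor_partition f) : R[i] :=
  \sum_(i < sp_size P) cintegral (chart_map (sp_chart i) @` sp_piece i)
    (fun q => potentialU H (sp_chart i) (sp_psi1 i) (sp_psi2 i) q *
              potentialV H (sp_chart i) (sp_psi1 i) (sp_psi2 i) q).

End Immersion.

(* Main.v *)
(* Put X = f^-1 f_x and Y = f^-1 f_y.  Since e^(2 alpha) = (|psi_1|^2 + |psi_2|^2)^2
   and the e_3-component n_3 of the normal is
   (|psi_2|^2 - |psi_1|^2) / (|psi_1|^2 + |psi_2|^2),
     UV = e^(2 alpha) ((H^2 - n_3^2 / 4) / 4 + i H n_3 / 4).
   In Nil the sectional curvature of a plane with normal n is 1/4 - n_3^2, so the
   real part of UV is the asserted integrand.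
   For the imaginary part one needs that H n_3 has integral 0 over M.  The e_3-component
   of the equation for nabla_{f_zbar} f_z reads d_x X_3 + d_y Y_3 = 2 e^(2 alpha) H n_3,
   i.e. 2 H n_3 is the divergence of the tangential part of the Killing field d/dz, and
   the divergence theorem on the closed surface M applies.  The latter is proved with
   the functions chi_j / sum_k chi_k, where each chi_j is a C^1 bump supported in a square
   of a conformal parameter; on such a square it is Fubini and the fundamental
   theorem of calculus. *)

Require Import Defs.
From HB Require Import structures.
From mathcomp Require Import all_boot all_order all_algebra.
From mathcomp Require Import complex.
From mathcomp Require Import all_classical all_reals all_analysis.
From mathcomp Require Import measurable_realfun.
From mathcomp Require Import ring lra.

Set Implicit Arguments.
Unset Strict Implicit.
Unset Printing Implicit Defensive.

Import Order.TTheory GRing.Theory Num.Theory.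
Import numFieldNormedType.Exports.

Local Open Scope classical_set_scope.
Local Open Scope ring_scope.
Local Open Scope complex_scope.

(** * Calculus in the plane *)

(** The mean curvature, the curvature function and the area measure are known only through the
    equations that they satisfy in charts, so regularity has to be established before anything is
    integrated. Pairing the equation for [nabla_zbar_z] with the normal expresses [H] through the
    frame, and its continuity follows from that formula. The immersion is smooth in the charts of
    the atlas, and the chain rule used here carries one derivative over to a conformal parameter.
    Second derivatives come from the spinor: its smoothness makes X and Y of class C^1. The
    connection disappears from the e_3-component because the Christoffel terms, contracted with dz -
    x dy, equal the term that the product rule produces from the coefficient x; this reflects that
    d/dz is Killing. Integrals in different parameters are compared through [mu], whose value is
    prescribed in each of them. Integrands are compared pointwise, since two conformal parameters
    are related by a Cauchy-Riemann Jacobian. *)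

Section PlaneCalculus.
Context {R : realType}.
Implicit Types (h g : plane R -> R) (q v : plane R).

Lemma growth_ex h q (t : R) : h (t *: ex + q) = h (t + q.1, q.2).
Proof.
congr h; apply: injective_projections => /=.
  by rewrite [_ *: _]mulr1.
by rewrite [_ *: _]mulr0 add0r.
Qed.

Lemma growth_ey h q (t : R) : h (t *: ey + q) = h (q.1, t + q.2).
Proof.
congr h; apply: injective_projections => /=.
  by rewrite [_ *: _]mulr0 add0r.
by rewrite [_ *: _]mulr1.
Qed.

Lemma derivable_ex h (x y : R) :
  derivable h (x, y) ex <-> derivable (fun t => h (t, y)) x 1.
Proof.
rewrite /derivable; suff -> : (fun t : R => t^-1 *: ((h \o shift (x, y)) (t *: ex) - h (x, y))) =
  (fun t : R => t^-1 *: (((fun t => h (t, y)) \o shift x) (t *: 1) - h (x, y))) by [].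
by apply/funext => t; rewrite /= growth_ex /= [t *: 1]mulr1.
Qed.

Lemma derivable_ey h (x y : R) :
  derivable h (x, y) ey <-> derivable (fun t => h (x, t)) y 1.
Proof.
rewrite /derivable; suff -> : (fun t : R => t^-1 *: ((h \o shift (x, y)) (t *: ey) - h (x, y))) =
  (fun t : R => t^-1 *: (((fun t => h (x, t)) \o shift y) (t *: 1) - h (x, y))) by [].
by apply/funext => t; rewrite /= growth_ey /= [t *: 1]mulr1.
Qed.

Lemma derive_ex h (x y : R) : 'D_ex h (x, y) = 'D_1 (fun t => h (t, y)) x.
Proof.
rewrite /derive; set F := fun _ => _; set G := fun _ => _; suff -> : F = G by [].
by apply/funext => t; rewrite /F /G /= growth_ex /= [t *: 1]mulr1.
Qed.

Lemma derive_ey h (x y : R) : 'D_ey h (x, y) = 'D_1 (fun t => h (x, t)) y.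
Proof.
rewrite /derive; set F := fun _ => _; set G := fun _ => _; suff -> : F = G by [].
by apply/funext => t; rewrite /F /G /= growth_ey /= [t *: 1]mulr1.
Qed.

(** The mean value theorem with an explicit error. The hypothesis covers both sides of [a], so it
    applies whichever of [a] and [b] is larger. *)
Lemma mvt_bound (f : R -> R) (a b c e : R) :
  (forall x, `|x - a| <= `|b - a| -> derivable f x 1 /\ `|'D_1 f x - c| <= e) ->
  `|f b - f a - c * (b - a)| <= e * `|b - a|.
Proof.
move=> H.
have key u w : u <= w -> (forall x, x \in `[u, w] -> derivable f x 1 /\ `|'D_1 f x - c| <= e) ->
    `|f w - f u - c * (w - u)| <= e * `|w - u|.
  move=> uw Hx.
  have [] := @MVT_segment _ f ('D_1 f) u w uw.
  - move=> x xuw; apply: derivableP.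
    by apply: (Hx _ _).1; exact: subset_itv_oo_cc.
  - by apply: derivable_within_continuous => x xuw; apply: (Hx _ xuw).1.
  - move=> x xuw ->; rewrite -mulrBl normrM ler_wpM2r//.
    exact: (Hx _ xuw).2.
have [ab|ba] := leP a b.
  apply: key => // x; rewrite in_itv/= => /andP[ax xb]; apply: H.
  by rewrite !ger0_norm ?subr_ge0// lerD2r.
have -> : `|f b - f a - c * (b - a)| = `|f a - f b - c * (a - b)|.
  by rewrite -normrN; congr (`|_|); ring.
rewrite (distrC b a); apply: key; first exact: ltW.
move=> x; rewrite in_itv/= => /andP[ax xb]; apply: H.
by rewrite distrC (distrC b) !ger0_norm ?subr_ge0// ?(ltW ba)// lerD2l lerN2.
Qed.

(** The increment is split along the path (x, y), (x, y + t), (x + s, y + t). On each leg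
    [mvt_bound] compares it with the partial derivative at [q], at the cost of half of the allowed
    error. *)
Lemma plane_differentiable h q :
  (\forall q' \near q, derivable h q' ex /\ derivable h q' ey) ->
  {for q, continuous ('D_ex h)} -> {for q, continuous ('D_ey h)} ->
  differentiable h q.
Proof.
case: q => x y; set q := (x, y) => nd cx cy.
pose d (v : plane R) : R := 'D_ex h q * v.1 + 'D_ey h q * v.2.
have lin_d : linear d.
  by move=> k u v; rewrite /d/= /GRing.scale/=; ring.
pose dM := GRing.isLinear.Build _ _ _ _ _ lin_d.
pose dL : {linear _ -> _} := HB.pack d dM.
have cd : continuous dL.
  move=> v; apply: cvgD; apply: cvgM; try exact: cvg_cst.
    exact: cvg_fst.
  exact: cvg_snd.
have U := @diff_unique R _ _ h dL q cd.
(* The premise of [diff_unique] is the first-order expansion with linear part [d]. Once proved as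
   [key], it both identifies the differential and yields differentiability. *)
match type of U with ?A -> _ => have key : A end; last first.
  by apply/diff_locallyP; rewrite (U key); split => //; exact: key.
  move=> {U}; apply/eqaddoP => _/posnumP[e].
  have e2 : 0 < e%:num / 2 by [].
  move/cvgrPdist_le : cx => /(_ _ e2) cx; move/cvgrPdist_le : cy => /(_ _ e2) cy.
  have : \forall q' \near q, (derivable h q' ex /\ derivable h q' ey) /\
      (`|'D_ex h q - 'D_ex h q'| <= e%:num / 2 /\ `|'D_ey h q - 'D_ey h q'| <= e%:num / 2).
    exact: filterI nd (filterI cx cy).
  move=> /nbhs_ballP[r /= r0 Hr].
  apply/nbhs_ballP; exists r => //= -[s t]; rewrite -ball_normE/= sub0r normrN => str.
  have [sr tr] : `|s| < r /\ `|t| < r.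
    by split; apply: le_lt_trans str; rewrite num_le_max lexx ?orbT.
  have B (a b : R) : `|a - x| < r -> `|b - y| < r -> ball (x, y) r (a, b).
    by move=> ax by_; split; rewrite -ball_normE/= distrC.
  have Y := @mvt_bound (fun b => h (x, b)) y (y + t) ('D_ey h (x, y)) (e%:num / 2).
  have X := @mvt_bound (fun a => h (a, y + t)) x (x + s) ('D_ex h (x, y)) (e%:num / 2).
  have {}Y : `|h (x, y + t) - h (x, y) - 'D_ey h (x, y) * t| <= e%:num / 2 * `|t|.
    have -> : h (x, y + t) - h (x, y) - 'D_ey h (x, y) * t =
      h (x, y + t) - h (x, y) - 'D_ey h (x, y) * (y + t - y) by ring.
    have {3}-> : t = y + t - y by ring.
    apply: Y => b; rewrite [y + t]addrC addrK => bt.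
    have bB : ball (x, y) r (x, b) by apply: B; rewrite ?subrr ?normr0// (le_lt_trans bt).
    have [[_ D] [_ C]] := Hr _ bB; split; first exact/derivable_ey.
    by rewrite distrC -derive_ey.
  have {}X : `|h (x + s, y + t) - h (x, y + t) - 'D_ex h (x, y) * s| <= e%:num / 2 * `|s|.
    have -> : h (x + s, y + t) - h (x, y + t) - 'D_ex h (x, y) * s =
      h (x + s, y + t) - h (x, y + t) - 'D_ex h (x, y) * (x + s - x) by ring.
    have {3}-> : s = x + s - x by ring.
    apply: X => b; rewrite [x + s]addrC addrK => bs.
    have bB : ball (x, y) r (b, y + t).
      by apply: B; rewrite ?(le_lt_trans bs)// [y + t]addrC addrK.
    have [[D _] [C _]] := Hr _ bB; split; first exact/derivable_ex.
    by rewrite distrC -derive_ex.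
  rewrite -[(_ - _) _]/(h (s + x, t + y) - (h (x, y) + ('D_ex h (x, y) * s + 'D_ey h (x, y) * t))).
  rewrite [s + x]addrC [t + y]addrC.
  rewrite (_ : _ - _ = (h (x + s, y + t) - h (x, y + t) - 'D_ex h (x, y) * s) +
    (h (x, y + t) - h (x, y) - 'D_ey h (x, y) * t)); last by ring.
  apply: (le_trans (ler_normD _ _)); apply: (le_trans (lerD X Y)).
  rewrite -mulrDr -mulrA ler_wpM2l// ler_pdivrMl// mulr_natl mulr2n.
  by apply: lerD; rewrite num_le_max lexx ?orbT.
Qed.

End PlaneCalculus.

(** * Functions of class C^1 at a point *)

Section C1.
Context {R : realType}.
Implicit Types (h g : plane R -> R) (q v : plane R).

(** Differentiability is asked near [q], continuity of the partials only at [q]. The condition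
    depends on the germ alone and passes through algebra and composition without any shrinking of
    domains. *)
Variant C1at h q : Prop := C1atDef of
  \forall q' \near q, differentiable h q' &
  {for q, continuous ('D_ex h)} & {for q, continuous ('D_ey h)}.

Lemma C1at_differentiable h q : C1at h q -> differentiable h q.
Proof. by case=> /nbhs_singleton. Qed.

Lemma C1at_derivable h q v : C1at h q -> derivable h q v.
Proof. by move=> /C1at_differentiable /diff_derivable. Qed.

Lemma C1at_continuous h q : C1at h q -> {for q, continuous h}.
Proof. by move=> /C1at_differentiable /differentiable_continuous. Qed.

Lemma near_eq_differentiable h g q :
  (\forall q' \near q, h q' = g q') -> differentiable h q -> differentiable g q.
Proof.
move=> hg dh; have hgq := nbhs_singleton hg.
have [cd E] := (diff_locallyP _ _).1 dh.
have U := @diff_unique R _ _ g ('d h q) q cd.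
match type of U with ?A -> _ => have key : A end; last first.
  by apply/diff_locallyP; rewrite (U key); split => //; exact: key.
apply/eqaddoP => e e0; have /eqaddoP/(_ e e0) := E.
have : \forall v \near (0 : plane R), h (v + q) = g (v + q).
  by move: hg; rewrite (near_shift 0 q); apply: filterS => v; rewrite /= subr0.
by apply: filterS2 => v /= hv; rewrite -[(_ - _) v]/(h (v + q) - (h q + 'd h q v))
  -[X in _ -> `|X| <= _]/(g (v + q) - (g q + 'd h q v)) hv hgq.
Qed.

Lemma near_eq_continuous_for (T U : topologicalType) (h g : T -> U) (q : T) :
  (\forall q' \near q, h q' = g q') -> {for q, continuous h} -> {for q, continuous g}.
Proof.
move=> hg ch; have E := nbhs_singleton hg.
rewrite /prop_for /continuous_at -E; apply: cvg_trans ch.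
apply: near_eq_cvg; exact: hg.
Qed.

Lemma continuous_forD (T : topologicalType) (h g : T -> R) (q : T) :
  {for q, continuous h} -> {for q, continuous g} -> {for q, continuous (fun p => h p + g p)}.
Proof. exact: cvgD. Qed.

Lemma continuous_forM (T : topologicalType) (h g : T -> R) (q : T) :
  {for q, continuous h} -> {for q, continuous g} -> {for q, continuous (fun p => h p * g p)}.
Proof. exact: cvgM. Qed.

Lemma C1at_near_eq h g q :
  (\forall q' \near q, h q' = g q') -> C1at h q -> C1at g q.
Proof.
move=> /near_join hg [dh cx cy]; split.
- by near=> p; apply: (@near_eq_differentiable h); near: p.
- apply: near_eq_continuous_for cx.
  by near=> p; apply: near_eq_derive; near: p.
- apply: near_eq_continuous_for cy.
  by near=> p; apply: near_eq_derive; near: p.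
Unshelve. all: by end_near. Qed.

(** [Ck] speaks of partial derivatives only, while the chain rule needs differentiability. As [D] is
    open, the partials exist and are continuous around every nearby point, which is what
    [plane_differentiable] asks. *)
Lemma Ck1_C1at (D : set (plane R)) h q : open D -> Ck 1 D h -> D q -> C1at h q.
Proof.
move=> oD [_ [dh [[cx _] [cy _]]]] Dq.
have cxq := cx q Dq; have cyq := cy q Dq.
have nD : \forall q' \near q, D q' by exact: open_nbhs_nbhs.
split; [|exact: cxq|exact: cyq]; near=> q'.
have Dq' : D q' by near: q'.
apply: plane_differentiable; [|exact: cx|exact: cy].
have: \forall q'' \near q', D q'' by exact: open_nbhs_nbhs.
by apply: filterS => q''; exact: dh.
Unshelve. all: by end_near. Qed.

Lemma C1at_cst (c : R) q : C1at (fun=> c) q.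
Proof.
split.
- by near=> q'; exact: differentiable_cst.
- rewrite (_ : 'D_ex _ = fun=> 0); first exact: cvg_cst.
  by apply/funext => q'; exact: derive_cst.
- rewrite (_ : 'D_ey _ = fun=> 0); first exact: cvg_cst.
  by apply/funext => q'; exact: derive_cst.
Unshelve. all: by end_near. Qed.

Lemma C1atI k a b q :
  (\forall p \near q, [/\ differentiable k p, 'D_ex k p = a p & 'D_ey k p = b p]) ->
  {for q, continuous a} -> {for q, continuous b} -> C1at k q.
Proof.
move=> nk ca cb; split.
- by apply: filterS nk => p [].
- apply: near_eq_continuous_for ca; apply: filterS nk => p [] _ ? _; exact: esym.
- apply: near_eq_continuous_for cb; apply: filterS nk => p [] _ _ ?; exact: esym.
Qed.

Lemma diff_deriveD h g p v : differentiable h p -> differentiable g p ->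
  'D_v (fun p => h p + g p) p = 'D_v h p + 'D_v g p.
Proof. by move=> dh dg; rewrite deriveD//; exact: diff_derivable. Qed.

Lemma diff_deriveM h g p v : differentiable h p -> differentiable g p ->
  'D_v (fun p => h p * g p) p = h p * 'D_v g p + g p * 'D_v h p.
Proof. by move=> dh dg; rewrite deriveM//; exact: diff_derivable. Qed.

Lemma C1atD h g q : C1at h q -> C1at g q -> C1at (fun p => h p + g p) q.
Proof.
move=> [dh hx hy] [dg gx gy].
apply: (@C1atI _ (fun p => 'D_ex h p + 'D_ex g p) (fun p => 'D_ey h p + 'D_ey g p)).
- apply: filterS2 dh dg => p dh dg; split; first exact: differentiableD.
  + exact: diff_deriveD.
  + exact: diff_deriveD.
- exact: (continuous_forD hx gx).
- exact: (continuous_forD hy gy).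
Qed.

Lemma C1atM h g q : C1at h q -> C1at g q -> C1at (fun p => h p * g p) q.
Proof.
move=> ch cg; have hc := C1at_continuous ch; have gc := C1at_continuous cg.
move: ch cg => [dh hx hy] [dg gx gy].
apply: (@C1atI _ (fun p => h p * 'D_ex g p + g p * 'D_ex h p)
                 (fun p => h p * 'D_ey g p + g p * 'D_ey h p)).
- apply: filterS2 dh dg => p dh dg; split; first exact: differentiableM.
  + exact: diff_deriveM.
  + exact: diff_deriveM.
- exact: (continuous_forD (continuous_forM hc gx) (continuous_forM gc hx)).
- exact: (continuous_forD (continuous_forM hc gy) (continuous_forM gc hy)).
Qed.

Lemma C1atZ (c : R) h q : C1at h q -> C1at (fun p => c * h p) q.
Proof. by move=> ch; exact: (C1atM (C1at_cst c q) ch). Qed.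

Lemma C1atN h q : C1at h q -> C1at (fun p => - h p) q.
Proof.
move=> ch; rewrite (_ : (fun p => _) = fun p => -1 * h p); first exact: C1atZ.
by apply/funext => p; rewrite mulN1r.
Qed.

Lemma C1atB h g q : C1at h q -> C1at g q -> C1at (fun p => h p - g p) q.
Proof. by move=> ch cg; exact: (C1atD ch (C1atN cg)). Qed.

Lemma derive_compE (U W : normedModType R) (g : U -> W) (h : W -> R) (q v : U) :
  differentiable g q -> differentiable h (g q) ->
  'D_v (h \o g) q = 'd h (g q) ('d g q v).
Proof.
move=> dg dh; rewrite deriveE; last exact: differentiable_comp.
by rewrite (diff_comp dg dh).
Qed.

Lemma derive_comp1 (phi dphi : R -> R) h q v :
  is_derive (h q) (1 : R) phi (dphi (h q)) -> differentiable h q ->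
  'D_v (fun p => phi (h p)) q = dphi (h q) * 'D_v h q.
Proof.
move=> [dp <-] dh; have {}dp : differentiable phi (h q) by exact/derivable1_diffP.
have E := derive_compE v dh dp; apply: (etrans E).
rewrite (deriveE _ dp) (deriveE _ dh) -['d h q v in LHS]mulr1.
by rewrite [LHS]linearZ mulrC.
Qed.

Lemma C1at_comp1 (phi dphi : R -> R) h q :
  (\forall t \near h q, is_derive t (1 : R) phi (dphi t)) -> {for h q, continuous dphi} ->
  C1at h q -> C1at (fun p => phi (h p)) q.
Proof.
move=> dp cp ch; have hc := C1at_continuous ch; move: ch => [dh hx hy].
have np : \forall p \near q, is_derive (h p) 1 phi (dphi (h p)).
  by have := hc _ dp.
have nd : \forall p \near q, differentiable phi (h p).
  by apply: filterS np => p [? _]; exact/derivable1_diffP.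
have cc : {for q, continuous (fun p => dphi (h p))}.
  exact: (@continuous_comp _ _ _ h dphi q hc cp).
apply: (@C1atI _ (fun p => dphi (h p) * 'D_ex h p) (fun p => dphi (h p) * 'D_ey h p)).
- apply: filterS3 np nd dh => p dp' dphip dh; split.
  + exact: (differentiable_comp dh dphip).
  + exact: (derive_comp1 _ dp' dh).
  + exact: (derive_comp1 _ dp' dh).
- exact: (continuous_forM cc hx).
- exact: (continuous_forM cc hy).
Qed.

Lemma C1atV h q : h q != 0 -> C1at h q -> C1at (fun p => (h p)^-1) q.
Proof.
move=> h0; apply: (@C1at_comp1 (GRing.inv) (fun t => - t ^- 2)).
  have : \forall t \near h q, t != 0.
    by apply: (@open_nbhs_nbhs _ (h q) [set t | t != 0]); split; [exact: open_neq|].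
  apply: filterS => t t0.
  have di : derivable (id : R -> R) t 1 by exact: derivable_id.
  apply: DeriveDef; first exact: (@derivableV _ _ id t 1 t0 di).
  by rewrite (@deriveV _ _ id t 1 t0 di) derive_id [LHS]mulr1.
apply: cvgN.
apply: cvgV; first by rewrite expf_neq0.
exact: exprn_continuous.
Qed.

Lemma plane_linearE (L : {linear plane R -> R}) (a b : R) :
  L (a, b) = L ex * a + L ey * b.
Proof.
have -> : (a, b) = a *: ex + b *: ey :> plane R.
  by apply: injective_projections => /=; rewrite [_ *: 1]mulr1 [_ *: 0]mulr0 ?addr0 ?add0r.
by rewrite [LHS]raddfD [X in X + _]linearZ [X in _ + X]linearZ [X in X + _]mulrC [X in _ + X]mulrC.
Qed.

Lemma derive_comp2 (t1 t2 : plane R -> R) h q v :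
  differentiable t1 q -> differentiable t2 q -> differentiable h (t1 q, t2 q) ->
  'D_v (fun p => h (t1 p, t2 p)) q =
  'D_ex h (t1 q, t2 q) * 'D_v t1 q + 'D_ey h (t1 q, t2 q) * 'D_v t2 q.
Proof.
move=> d1 d2 dh; have dt := differentiable_pair d1 d2.
have E := derive_compE v dt dh; apply: (etrans E).
rewrite (deriveE _ dh) (deriveE _ dh) (deriveE _ d1) (deriveE _ d2).
have -> : 'd (fun p => (t1 p, t2 p)) q v = ('d t1 q v, 'd t2 q v).
  by rewrite (diff_pair d1 d2).
exact: plane_linearE.
Qed.

Lemma C1at_comp2 (t1 t2 : plane R -> R) h q :
  C1at t1 q -> C1at t2 q -> C1at h (t1 q, t2 q) -> C1at (fun p => h (t1 p, t2 p)) q.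
Proof.
move=> c1 c2 ch.
have cc : {for q, continuous (fun p => (t1 p, t2 p))}.
  exact: (cvg_pair (C1at_continuous c1) (C1at_continuous c2)).
move: c1 c2 ch => [d1 x1 y1] [d2 x2 y2] [dh xh yh].
have nh : \forall p \near q, differentiable h (t1 p, t2 p) by have := cc _ dh.
have cx : {for q, continuous (fun p => 'D_ex h (t1 p, t2 p))}.
  exact: (@continuous_comp _ _ _ (fun p => (t1 p, t2 p)) ('D_ex h) q cc xh).
have cy : {for q, continuous (fun p => 'D_ey h (t1 p, t2 p))}.
  exact: (@continuous_comp _ _ _ (fun p => (t1 p, t2 p)) ('D_ey h) q cc yh).
apply: (@C1atI _ (fun p => 'D_ex h (t1 p, t2 p) * 'D_ex t1 p + 'D_ey h (t1 p, t2 p) * 'D_ex t2 p)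
  (fun p => 'D_ex h (t1 p, t2 p) * 'D_ey t1 p + 'D_ey h (t1 p, t2 p) * 'D_ey t2 p)).
- apply: filterS3 d1 d2 nh => p d1 d2 dhp; split.
  + exact: (differentiable_comp (differentiable_pair d1 d2) dhp).
  + exact: (derive_comp2 _ d1 d2 dhp).
  + exact: (derive_comp2 _ d1 d2 dhp).
- exact: (continuous_forD (continuous_forM cx x1) (continuous_forM cy x2)).
- exact: (continuous_forD (continuous_forM cx y1) (continuous_forM cy y2)).
Qed.

(** The squared positive part: of class C^1, and positive exactly at positive arguments. It is the
    one-variable ingredient of the bumps. *)
Definition sqpos (t : R) : R := (Num.max 0 t) ^+ 2.

(** The hypothesis keeps the difference quotient within [|s|] of [c]. For [sqpos] the bound holds at
    every [t], so the kink of the positive part is no special case. *)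
Lemma is_derive_quadratic (phi : R -> R) (t c : R) :
  (forall s, `|phi (s + t) - phi t - c * s| <= s ^+ 2) -> is_derive t (1 : R) phi c.
Proof.
move=> H.
have L : (fun s : R => s^-1 *: ((phi \o shift t) (s *: 1) - phi t)) @ 0^' --> c.
  apply/cvgrPdist_le => e e0; near=> s.
  have s0 : s != 0 by near: s; exact: nbhs_dnbhs_neq.
  rewrite /= [s *: 1]mulr1 -[_ *: _]/(_ * _).
  rewrite (_ : c - _ = - (s^-1 * (phi (s + t) - phi t - c * s))); last by field.
  rewrite normrN normrM normfV ler_pdivrMl ?normr_gt0//.
  apply: (le_trans (H s)); rewrite -normr_id -real_normK ?num_real// normr_id expr2 ler_wpM2l//.
  near: s; apply: dnbhs0_le => //.
by split; [apply/cvg_ex; exists c|exact: cvg_lim].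
Unshelve. all: by end_near. Qed.

Lemma sqpos_derive (t : R) : is_derive t (1 : R) sqpos (2 * Num.max 0 t).
Proof.
apply: is_derive_quadratic => s; rewrite /sqpos ler_norml.
have [h1|h1] := leP 0 (s + t); have [h2|h2] := leP 0 t; apply/andP; split; nra.
Qed.

Lemma C1at_sqpos h q : C1at h q -> C1at (fun p => sqpos (h p)) q.
Proof.
apply: (@C1at_comp1 sqpos (fun t => 2 * Num.max 0 t)).
  by near=> t; exact: sqpos_derive.
apply: cvgM; first exact: cvg_cst.
apply: (@continuous_max _ _ (fun=> 0) id); first exact: cvg_cst.
exact: cvg_id.
Unshelve. all: by end_near. Qed.

Lemma C1at_of_derivable k a b q :
  (forall p, [/\ derivable k p ex, derivable k p ey, 'D_ex k p = a p & 'D_ey k p = b p]) ->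
  continuous a -> continuous b -> C1at k q.
Proof.
move=> H ca cb.
have ea : 'D_ex k = a by apply/funext => p; have [] := H p.
have eb : 'D_ey k = b by apply/funext => p; have [] := H p.
apply: C1atDef; [|rewrite ea; exact: ca|rewrite eb; exact: cb].
near=> p; apply: plane_differentiable; [|rewrite ea; exact: ca|rewrite eb; exact: cb].
by near=> p'; have [] := H p'.
Unshelve. all: by end_near. Qed.

Lemma C1at_fst q : C1at fst q.
Proof.
apply: (@C1at_of_derivable _ (fun=> 1) (fun=> 0)); try by move=> p; exact: cvg_cst.
case=> x y; split.
- by apply/derivable_ex; exact: derivable_id.
- by apply/derivable_ey; exact: derivable_cst.
- by rewrite derive_ex derive_id.
- by rewrite derive_ey derive_cst.
Qed.

Lemma C1at_snd q : C1at snd q.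
Proof.
apply: (@C1at_of_derivable _ (fun=> 0) (fun=> 1)); try by move=> p; exact: cvg_cst.
case=> x y; split.
- by apply/derivable_ex; exact: derivable_cst.
- by apply/derivable_ey; exact: derivable_id.
- by rewrite derive_ex derive_cst.
- by rewrite derive_ey derive_id.
Qed.

End C1.

(** * Measure and integration in the plane *)

Section PlaneMeasure.
Context {R : realType}.
Implicit Types (D : set (plane R)) (u : plane R -> R).

Local Notation mplane := (measurableTypeR R * measurableTypeR R)%type.

Lemma rat_box (x e : R) : 0 < e ->
  exists a b : rat, (ratr a < x < ratr b) /\ forall t : R, ratr a < t < ratr b -> `|x - t| < e.
Proof.
move=> e0.
have xe : x - e < x by rewrite ltrBlDr ltrDl.
have ex' : x < x + e by rewrite ltrDl.
have [a] := rat_in_itvoo xe; rewrite in_itv/= => /andP[ea ax].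
have [b] := rat_in_itvoo ex'; rewrite in_itv/= => /andP[xb be].
exists a, b; split; first by rewrite ax xb.
move=> t /andP[at_ tb]; rewrite ltr_distlC; apply/andP; split.
  exact: lt_trans at_.
exact: lt_trans be.
Qed.

(** The sigma-algebra of the plane is the product one, generated by rectangles. An open set belongs
    to it as the union of the countably many rational boxes that it contains. *)
Lemma plane_open_measurable D : open D -> measurable (D : set mplane).
Proof.
move=> oD.
pose B (k : rat * rat * (rat * rat)) : set (plane R) :=
  `]ratr k.1.1, ratr k.1.2[%classic `*` `]ratr k.2.1, ratr k.2.2[%classic.
have -> : D = \bigcup_(k : rat * rat * (rat * rat)) (if `[< B k `<=` D >] then B k else set0).
  apply/seteqP; split => [[x y] Dxy|p [k _]]; last first.
    by case: ifPn => // /asboolP Bk; exact: Bk.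
  have /nbhs_ballP[e /= e0 eD] : nbhs (x, y) D by exact: open_nbhs_nbhs.
  have [a [b [xab abe]]] := rat_box x e0.
  have [c [d [ycd cde]]] := rat_box y e0.
  exists ((a, b), (c, d)) => //; rewrite asboolT; last first.
    by move=> [s t] [/= sab tcd]; apply: eD; split; rewrite -ball_normE/=;
      [apply: abe|apply: cde]; rewrite in_itv/= in sab tcd.
  by split; rewrite /= in_itv/=.
apply: countable_bigcupT_measurable; first exact: countableP.
move=> k; case: ifPn => // _.
by apply: measurableX; exact: measurable_itv.
Qed.

Lemma measurable_fun_RGenOpens d (T : measurableType d) (D : set T) (h : T -> R) :
  (forall U, open U -> measurable (D `&` h @^-1` U)) ->
  measurable_fun D (h : T -> measurableTypeR R).
Proof.
move=> H; apply: (measurability _ (RGenOpens.measurableE R)).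
move=> _ [_ [a [b ->] <-]]; apply: H; exact: interval_open.
Qed.

Lemma measurable_fun_borel d (T : measurableType d) (M : ptopologicalType)
    (D : set T) (h : T -> M) :
  (forall U, open U -> measurable (D `&` h @^-1` U)) ->
  measurable_fun D (h : T -> borel M).
Proof.
move=> H; apply: (@measurability _ _ T (borel M) D h (@open M)); first by [].
by move=> _ [U oU <-]; exact: H.
Qed.

Lemma plane_preimage_measurable (T : topologicalType) D (h : plane R -> T) (U : set T) :
  measurable (D : set mplane) -> (forall q, D q -> {for q, continuous h}) -> open U ->
  measurable (D `&` h @^-1` U : set mplane).
Proof.
move=> mD ch oU.
(* Continuity is known at the points of [D] as points of the plane, so on [D] the preimage coincides
   with its interior. *)
have -> : D `&` h @^-1` U = D `&` (h @^-1` U)°.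
  apply/seteqP; split => q [Dq hU]; split => //; last exact: interior_subset.
  by apply: (ch q Dq); exact: open_nbhs_nbhs.
by apply: measurableI => //; apply: plane_open_measurable; exact: open_interior.
Qed.

Lemma plane_measurable_fun D (h : plane R -> R) :
  measurable (D : set mplane) -> (forall q, D q -> {for q, continuous h}) ->
  measurable_fun (D : set mplane) (h : mplane -> measurableTypeR R).
Proof.
move=> mD ch; apply: measurable_fun_RGenOpens => U oU.
exact: plane_preimage_measurable.
Qed.

(** Closed, hence compact, which bounds continuous integrands; a product of intervals, which suits
    Fubini. *)
Definition square (q : plane R) (r : R) : set (plane R) :=
  `[q.1 - r, q.1 + r]%classic `*` `[q.2 - r, q.2 + r]%classic.

Lemma square_measurable q r : measurable (square q r : set mplane).
Proof. by apply: measurableX; exact: measurable_itv. Qed.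

Lemma square_compact q r : compact (square q r).
Proof. by apply: compact_setX; exact: segment_compact. Qed.

Lemma square_finite q r : (lebesgue2 (square q r : set mplane) < +oo)%E.
Proof.
rewrite product_measure1E; [|exact: measurable_itv|exact: measurable_itv].
have F x : lebesgue_measure (`[x - r, x + r]%classic : set R) \is a fin_num.
  by rewrite lebesgue_measure_itv/=; case: ifP => _; rewrite -?EFinB.
have := fin_numM (F q.1) (F q.2); rewrite fin_numElt => /andP[_]; exact: id.
Qed.

Lemma square_integrable q r (h : plane R -> R) :
  (forall p, square q r p -> {for p, continuous h}) ->
  lebesgue2.-integrable (square q r : set mplane) (fun p => (h p)%:E).
Proof.
move=> ch; apply: measurable_bounded_integrable.
- exact: square_measurable.
- exact: square_finite.
- by apply: plane_measurable_fun => //; exact: square_measurable.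
- have : compact (h @` square q r).
    apply: continuous_compact; last exact: square_compact.
    by apply/continuous_in_subspaceT => p; rewrite inE; exact: ch.
  move=> /compact_bounded [M [Mr HM]]; exists M; split => // x Mx p sp.
  by apply: (HM x Mx); exists p.
Qed.

Lemma square_in_open D q : open D -> D q ->
  exists2 r : R, 0 < r & square q r `<=` D.
Proof.
move=> oD Dq; have /nbhs_ballP[e /= e0 eD] : nbhs q D by exact: open_nbhs_nbhs.
exists (e / 2); first by rewrite divr_gt0.
move=> [x y] [/= xr yr]; apply: eD; rewrite !in_itv/= in xr yr.
split; rewrite -ball_normE/= ltr_norml; lra.
Qed.

End PlaneMeasure.

(** * Integrals of partial derivatives over a square *)

Section Divergence.
Context {R : realType}.
Implicit Types (u : plane R -> R).
Local Notation mplane := (measurableTypeR R * measurableTypeR R)%type.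

Lemma FTC_on_segment (F f : R -> R) (a b : R) : a < b ->
  (forall x, a <= x <= b -> [/\ derivable F x 1, 'D_1 F x = f x & {for x, continuous f}]) ->
  (\int[lebesgue_measure]_(x in `[a, b]) (f x)%:E = (F b)%:E - (F a)%:E)%E.
Proof.
move=> ab H.
have cF x : a <= x <= b -> {for x, continuous F}.
  by move=> xab; have [dF _ _] := H x xab; apply: differentiable_continuous; exact/derivable1_diffP.
apply: (@continuous_FTC2 _ f F) => //.
- apply/continuous_in_subspaceT => x; rewrite inE/= in_itv/= => xab.
  by case: (H x xab).
- split.
  + move=> x; rewrite in_itv/= => /andP[ax xb].
    by case: (H x); rewrite ?(ltW ax) ?(ltW xb).
  + by apply: cvg_at_right_filter; apply: cF; rewrite lexx ltW.
  + by apply: cvg_at_left_filter; apply: cF; rewrite lexx ltW.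
- move=> x; rewrite in_itv/= => /andP[ax xb].
  by rewrite derive1E; case: (H x); rewrite ?(ltW ax) ?(ltW xb).
Qed.

Lemma C1at_FTC_ex u (a b y : R) : a < b ->
  (forall x, a <= x <= b -> C1at u (x, y)) ->
  (\int[lebesgue_measure]_(x in `[a, b]) ('D_ex u (x, y))%:E = (u (b, y))%:E - (u (a, y))%:E)%E.
Proof.
move=> ab cu; apply: (@FTC_on_segment (fun x => u (x, y)) (fun x => 'D_ex u (x, y))) => // x xab.
have ca := cu x xab; split; first by apply/derivable_ex; exact: C1at_derivable.
  by rewrite derive_ex.
have [_ cx _] := ca; apply: (@continuous_comp _ _ _ (fun t => (t, y)) ('D_ex u) x _ cx).
have c1 : {for x, continuous (fun t : R => t)} by exact: cvg_id.
have c2 : {for x, continuous (fun _ : R => y)} by exact: cvg_cst.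
exact: (cvg_pair c1 c2).
Qed.

Lemma C1at_FTC_ey u (x a b : R) : a < b ->
  (forall y, a <= y <= b -> C1at u (x, y)) ->
  (\int[lebesgue_measure]_(y in `[a, b]) ('D_ey u (x, y))%:E = (u (x, b))%:E - (u (x, a))%:E)%E.
Proof.
move=> ab cu; apply: (@FTC_on_segment (fun y => u (x, y)) (fun y => 'D_ey u (x, y))) => // y yab.
have ca := cu y yab; split; first by apply/derivable_ey; exact: C1at_derivable.
  by rewrite derive_ey.
have [_ _ cy] := ca; apply: (@continuous_comp _ _ _ (fun t => (x, t)) ('D_ey u) y _ cy).
have c1 : {for y, continuous (fun _ : R => x)} by exact: cvg_cst.
have c2 : {for y, continuous (fun t : R => t)} by exact: cvg_id.
exact: (cvg_pair c1 c2).
Qed.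

(** Fubini with x as the inner variable: on each horizontal segment the fundamental theorem of
    calculus leaves a difference of two edge values, both 0. *)
Lemma integral_square_ex u q r : 0 < r ->
  (forall p, square q r p -> C1at u p) ->
  (forall y, q.2 - r <= y <= q.2 + r -> u (q.1 - r, y) = 0 /\ u (q.1 + r, y) = 0) ->
  (\int[lebesgue2]_(p in (square q r : set mplane)) ('D_ex u p)%:E = 0)%E.
Proof.
move=> r0 cu ulr.
have iu := @square_integrable _ q r ('D_ex u) (fun p sp => let: C1atDef _ c _ := cu p sp in c).
(* Fubini is applied on the whole plane, so the square is first absorbed into the integrand,
   extended by 0. *)
rewrite integral_mkcond -integral21_prod_meas1; last first.
  exact: ((integrable_mkcond _ (square_measurable q r)).1 iu).
apply: integral0_eq => y _.
have [yr|yr] := boolP (y \in `[q.2 - r, q.2 + r]); last first.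
  apply: integral0_eq => x _; rewrite patchE; case: ifPn => //.
  by rewrite inE => -[_ /= yr']; rewrite yr' in yr.
transitivity (\int[lebesgue_measure]_(x in `[(q.1 - r)%R, (q.1 + r)%R]) ('D_ex u (x, y))%:E)%E.
  rewrite [RHS]integral_mkcond; apply: eq_integral => x _; rewrite !patchE.
  by congr (if _ then _ else _); apply/idP/idP; rewrite !inE /square/= => // -[].
have [ul ur] : u (q.1 - r, y) = 0 /\ u (q.1 + r, y) = 0 by apply: ulr; rewrite in_itv in yr.
rewrite C1at_FTC_ex ?ul ?ur ?subee//; first by move: r0; clear; lra.
by move=> x xr; apply: cu; split; rewrite /= in_itv.
Qed.

Lemma integral_square_ey u q r : 0 < r ->
  (forall p, square q r p -> C1at u p) ->
  (forall x, q.1 - r <= x <= q.1 + r -> u (x, q.2 - r) = 0 /\ u (x, q.2 + r) = 0) ->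
  (\int[lebesgue2]_(p in (square q r : set mplane)) ('D_ey u p)%:E = 0)%E.
Proof.
move=> r0 cu ulr.
have iu := @square_integrable _ q r ('D_ey u) (fun p sp => let: C1atDef _ _ c := cu p sp in c).
rewrite integral_mkcond -integral12_prod_meas1; last first.
  exact: ((integrable_mkcond _ (square_measurable q r)).1 iu).
apply: integral0_eq => x _.
have [xr|xr] := boolP (x \in `[q.1 - r, q.1 + r]); last first.
  apply: integral0_eq => y _; rewrite patchE; case: ifPn => //.
  by rewrite inE => -[/= xr' _]; rewrite xr' in xr.
transitivity (\int[lebesgue_measure]_(y in `[(q.2 - r)%R, (q.2 + r)%R]) ('D_ey u (x, y))%:E)%E.
  rewrite [RHS]integral_mkcond; apply: eq_integral => y _; rewrite !patchE.
  by congr (if _ then _ else _); apply/idP/idP; rewrite !inE /square/= => // -[].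
have [ul ur] : u (x, q.2 - r) = 0 /\ u (x, q.2 + r) = 0 by apply: ulr; rewrite in_itv in xr.
rewrite C1at_FTC_ey ?ul ?ur ?subee//; first by move: r0; clear; lra.
by move=> y yr; apply: cu; split; rewrite /= in_itv.
Qed.

End Divergence.

(** * Integrals against a measure given by a density in a parameter *)

Section DensityTransfer.
Context d1 d2 (X : measurableType d1) (Y : measurableType d2) (R : realType).
Variables (mu : {measure set X -> \bar R}) (L : {measure set Y -> \bar R}).
Variables (A : set X) (B : set Y) (phi : Y -> X) (w : Y -> R).
Hypotheses (mA : measurable A) (mB : measurable B) (mphi : measurable_fun B phi).
Hypotheses (mw : measurable_fun B w) (w0 : forall y, B y -> 0 <= w y).
Hypothesis phiA : forall y, B y -> A (phi y).
Hypothesis muE : forall E, measurable E -> E `<=` A ->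
  mu E = (\int[L]_(y in B `&` phi @^-1` E) (w y)%:E)%E.

Import HBNNSimple.
Local Open Scope ereal_scope.

(** By monotone convergence both sides are limits of the corresponding integrals for the simple
    functions [h n]. For these the claim reduces to level sets, where it is [muE]. *)
Lemma ge0_integral_density (f : X -> \bar R) :
  measurable_fun A f -> (forall x, A x -> 0 <= f x) ->
  \int[mu]_(x in A) f x = \int[L]_(y in B) (f (phi y) * (w y)%:E).
Proof.
move=> mf f0; pose h := nnsfun_approx mA mf.
have wE0 y : B y -> 0 <= (w y)%:E by move=> By; rewrite lee_fin; exact: w0.
have mwE : measurable_fun B (EFin \o w) by exact/measurable_EFinP.
have mcomp (g : X -> R) : measurable_fun A g -> measurable_fun B (fun y => (g (phi y))%:E).
  move=> mg; apply/measurable_EFinP; apply: (measurable_comp mA _ mg mphi).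
  by move=> _ [y By <-]; exact: phiA.
have -> : \int[mu]_(x in A) f x = lim (\int[mu]_(x in A) (EFin \o h n) x @[n --> \oo]).
  have fE x : A x -> f x = lim ((EFin \o h n) x @[n --> \oo]).
    by move=> Ax; apply/esym/cvg_lim => //; exact: cvg_nnsfun_approx.
  under eq_integral => x /[!inE] /fE -> //.
  apply: monotone_convergence => //.
  - move=> n; apply/measurable_EFinP.
    by apply: (measurable_funS measurableT) => //; exact/measurable_funP.
  - by move=> n x Ax //=; rewrite lee_fin.
  - by move=> x Ax a b ab; rewrite lee_fin; exact/lefP/nd_nnsfun_approx.
have -> : \int[L]_(y in B) (f (phi y) * (w y)%:E) =
    lim (\int[L]_(y in B) ((h n (phi y))%:E * (w y)%:E) @[n --> \oo]).
  have fE y : B y -> f (phi y) * (w y)%:E = lim ((h n (phi y))%:E * (w y)%:E @[n --> \oo]).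
    by move=> By; apply/esym/cvg_lim => //; apply: cvgeZr => //;
      apply: cvg_nnsfun_approx => //; exact: phiA.
  under eq_integral => x /[!inE] /fE -> //.
  apply: monotone_convergence => //.
  - move=> n; apply: emeasurable_funM => //; apply: mcomp.
    by apply: (measurable_funS measurableT) => //; exact/measurable_funP.
  - by move=> n y By; rewrite mule_ge0 ?wE0// lee_fin.
  - by move=> y By a b ab; rewrite lee_wpmul2r ?wE0// lee_fin; exact/lefP/nd_nnsfun_approx.
suff key n : \int[mu]_(x in A) (EFin \o h n) x = \int[L]_(y in B) ((h n (phi y))%:E * (w y)%:E).
  by under eq_fun do rewrite key.
have mind r : measurable_fun A (fun x => (r * \1_(h n @^-1` [set r]) x)%R).
  by apply: measurable_funM; [exact: measurable_cst|exact: measurable_indic].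
transitivity (\int[mu]_(x in A)
   (\sum_(r \in range (h n)) (r * \1_(h n @^-1` [set r]) x)%:E)).
  by apply: eq_integral => t tE; rewrite /= fimfunE -fsumEFin.
rewrite ge0_integral_fsum//; last 2 first.
- by move=> r; exact/measurable_EFinP.
- by move=> r x Ax; exact: nnfun_muleindic_ge0.
transitivity (\int[L]_(y in B) (\sum_(r \in range (h n))
    ((r * \1_(h n @^-1` [set r]) (phi y))%:E * (w y)%:E))); last first.
  apply: eq_integral => y yB.
  rewrite -ge0_mule_fsuml => [|r]; last exact: nnfun_muleindic_ge0.
  by rewrite fsumEFin// -fimfunE.
rewrite ge0_integral_fsum//; last 2 first.
- move=> r; apply: emeasurable_funM => //.
  exact: (mcomp (fun x => r * \1_(h n @^-1` [set r]) x)%R).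
- by move=> r y By; rewrite mule_ge0 ?wE0// nnfun_muleindic_ge0.
apply: eq_fsbigr => r rhn.
rewrite integralZl_indic_nnsfun// integral_indic//.
have r0 : (0 <= r)%R by move: rhn; rewrite inE => -[t _ <-].
under eq_integral do rewrite EFinM -muleA.
rewrite ge0_integralZl//; last 2 first.
- apply: emeasurable_funM => //; apply: (mcomp (\1_(h n @^-1` [set r]) : X -> R)).
  exact: measurable_indic.
- by move=> y By; rewrite mule_ge0 ?wE0// lee_fin.
congr (_ * _); rewrite muE; [|by apply: measurableI|exact: subIsetr].
under [RHS]eq_integral do rewrite muleC.
rewrite (_ : B `&` _ = B `&` phi @^-1` (h n @^-1` [set r])); last first.
  by apply/seteqP; split => y [By]; [case|]; split => //; split => //; exact: phiA.
rewrite integral_mkcondr; apply: eq_integral => y yB.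
by rewrite epatch_indic.
Qed.

Lemma integral_density (f : X -> R) :
  mu.-integrable A (EFin \o f) ->
  L.-integrable B (fun y => (f (phi y) * w y)%:E) /\
  \int[mu]_(x in A) (f x)%:E = \int[L]_(y in B) (f (phi y) * w y)%:E.
Proof.
move=> intf; have mf := measurable_int _ intf.
have mcomp (g : X -> \bar R) : measurable_fun A g -> measurable_fun B (g \o phi).
  move=> mg; apply: (measurable_comp mA _ mg mphi).
  by move=> _ [y By <-]; exact: phiA.
have mfw : measurable_fun B (fun y => (f (phi y) * w y)%:E).
  apply/measurable_EFinP/measurable_funM => //.
  by apply/measurable_EFinP; exact: mcomp mf.
(* Since [w] is nonnegative on [B], multiplication by it commutes with taking positive and negative
   parts. *)
have pE y : B y -> (EFin \o f)^\+ (phi y) * (w y)%:E = (fun y => (f (phi y) * w y)%:E)^\+ y.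
  move=> By; rewrite !funeposE/= -!EFin_max -EFinM maxr_pMl ?w0// mul0r.
  by [].
have nE y : B y -> (EFin \o f)^\- (phi y) * (w y)%:E = (fun y => (f (phi y) * w y)%:E)^\- y.
  move=> By; rewrite !funenegE/= -!EFin_max -EFinM maxr_pMl ?w0// mul0r mulNr.
  by [].
split.
  apply/integrableP; split=> //.
  have /integrableP[_] := intf; apply: le_lt_trans.
  rewrite (@ge0_integral_density (fun x => `|(f x)%:E|))//; last exact: measurableT_comp.
  under [X in _ <= X]eq_integral => y.
    rewrite inE => By; rewrite -[(w y)%:E]gee0_abs ?lee_fin ?w0// -abseM -EFinM; over.
  exact: lexx.
rewrite integralE [RHS]integralE.
rewrite ge0_integral_density//; last exact: measurable_funepos.
rewrite ge0_integral_density//; last exact: measurable_funeneg.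
congr (_ - _).
- by apply: eq_integral => y; rewrite inE => By; rewrite pE.
- by apply: eq_integral => y; rewrite inE => By; rewrite nE.
Qed.

End DensityTransfer.

(** * The geometry of Nil *)

Section NilAlgebra.

Lemma sum_ord3 (V : nmodType) (F : 'I_3 -> V) : \sum_i F i = F 0 + F 1 + F 2.
Proof.
by rewrite !big_ord_recl big_ord0 addr0 addrA; congr (F _ + F _ + F _); apply: val_inj.
Qed.

Lemma ord3P (P : 'I_3 -> Prop) : P 0 -> P 1 -> P 2 -> forall i, P i.
Proof.
move=> P0 P1 P2 [[|[|[|//]]]] Hi.
- by rewrite (_ : Ordinal Hi = 0)//; apply: val_inj.
- by rewrite (_ : Ordinal Hi = 1)//; apply: val_inj.
- by rewrite (_ : Ordinal Hi = 2)//; apply: val_inj.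
Qed.

Lemma mulmx1_invmx (K : comUnitRingType) n (A B : 'M[K]_n) : A *m B = 1%:M -> invmx A = B.
Proof.
move=> AB; have [uA _] := mulmx1_unit AB.
by rewrite -[LHS]mulmx1 -AB mulmxA mulVmx// mul1mx.
Qed.

Section Lie.
Context {K : comUnitRingType}.
Implicit Types p v w : 'rV[K]_3.

Definition nil_inv p : 'rV[K]_3 := \row_k
  (if k == 0 then - p 0 0 else if k == 1 then - p 0 1 else p 0 0 * p 0 1 - p 0 2).

Lemma nil_mxE p : nil_mx p = \matrix_(i, j)
  (if i == 0 then if j == 0 then 1 else if j == 1 then p 0 0 else p 0 2
   else if i == 1 then if j == 0 then 0 else if j == 1 then 1 else p 0 1
   else if j == 2 then 1 else 0).
Proof.
apply/matrixP => i j; rewrite /nil_mx /nil_lie sum_ord3 !mxE /=.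
move: i j; apply: ord3P; apply: ord3P;
  by rewrite /= ?(mulr0, mulr1, addr0, add0r).
Qed.

Lemma left_to_lieE p w k : left_to_lie p w 0 k =
  if k == 2 then w 0 2 - p 0 0 * w 0 1 else w 0 k.
Proof.
have -> : left_to_lie p w = nil_coord (nil_mx (nil_inv p) *m nil_lie w).
  rewrite /left_to_lie (mulmx1_invmx (B := nil_mx (nil_inv p)))//.
  rewrite !nil_mxE; apply/matrixP => i j; rewrite !mxE sum_ord3 !mxE /=.
  by move: i j; apply: ord3P; apply: ord3P; rewrite /=; ring.
rewrite nil_mxE /nil_coord /nil_lie !mxE sum_ord3 !mxE !sum_ord3 !mxE /=.
by move: k; apply: ord3P; rewrite /=; ring.
Qed.

Lemma left_from_lieE p v k : left_from_lie p v 0 k =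
  if k == 2 then v 0 2 + p 0 0 * v 0 1 else v 0 k.
Proof.
rewrite /left_from_lie nil_mxE /nil_coord /nil_lie !mxE sum_ord3 !mxE !sum_ord3 !mxE /=.
by move: k; apply: ord3P; rewrite /=; ring.
Qed.

End Lie.

Section Metric.
Context {R : realType}.
Implicit Types p v w : 'rV[R]_3.

(** The metric coefficients and the Christoffel symbols of Nil are polynomials of degree at most 2
    in x alone, so [derive_quad] covers every derivative in the curvature computation. *)
Definition quad (a b c t : R) : R := a + b * t + c * t ^+ 2.

Lemma derive_quad (a b c t : R) : 'D_1 (quad a b c) t = b + 2 * c * t.
Proof.
have [_ D] : is_derive t (1 : R) (cst a + b \*: id + c \*: (id * id))
    (0 + b *: 1 + c *: (t *: 1 + t *: 1)).
  by apply: is_derive_eq.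
have -> : quad a b c = cst a + b \*: id + c \*: (id * id).
  by apply/funext => x; rewrite /quad expr2.
by rewrite D /GRing.scale /=; ring.
Qed.

Lemma pd_coord0 (phi : R -> R) i p :
  pd i (fun p' => phi (p' 0 0)) p = if i == 0 then 'D_1 phi (p 0 0) else 0.
Proof.
have E (t : R) : phi ((t *: delta_mx 0 i + p) 0 0) - phi (p 0 0) =
    if i == 0 then phi (t *: 1 + p 0 0) - phi (p 0 0) else 0.
  rewrite !mxE eqxx /= eq_sym; case: ifP => _; first by [].
  by rewrite mulr0 add0r subrr.
rewrite /pd /derive; case: ifP E => i0 E.
  set F := fun _ => _; set G := fun _ => _; suff -> : F = G by [].
  by apply/funext => t; rewrite /F /G /= E.
rewrite (_ : (fun _ => _) = fun=> 0); first by rewrite lim_cst.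
by apply/funext => t; rewrite /= E scaler0.
Qed.

Lemma nil_gE p i j : nil_g p i j =
  if i == 0 then if j == 0 then 1 else 0
  else if i == 1 then if j == 0 then 0 else if j == 1 then 1 + p 0 0 ^+ 2 else - p 0 0
  else if j == 0 then 0 else if j == 1 then - p 0 0 else 1.
Proof.
rewrite /nil_g /nil_form !mxE.
by move: i j; apply: ord3P; apply: ord3P; rewrite /=; ring.
Qed.

Lemma metric_nil_g p v w : metric nil_g p v w = nil_form p v w.
Proof.
by rewrite /metric /nil_form !sum_ord3 !nil_gE /=; ring.
Qed.

Lemma invmx_nil_gE p i j : invmx (nil_g p) i j =
  if i == 0 then if j == 0 then 1 else 0
  else if i == 1 then if j == 0 then 0 else if j == 1 then 1 else p 0 0
  else if j == 0 then 0 else if j == 1 then p 0 0 else 1 + p 0 0 ^+ 2.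
Proof.
pose B := \matrix_(i, j) (if i == 0 then if j == 0 then 1 else 0
  else if i == 1 then if j == 0 then 0 else if j == 1 then 1 else p 0 0
  else if j == 0 then 0 else if j == 1 then p 0 0 else 1 + p 0 0 ^+ 2) : 'M[R]_3.
rewrite (mulmx1_invmx (B := B)); first by rewrite mxE.
apply/matrixP => {}i {}j; rewrite !mxE sum_ord3 !nil_gE !mxE /=.
by move: i j; apply: ord3P; apply: ord3P; rewrite /=; ring.
Qed.

(** The symbols belong to the coordinates (x, y, z) and not to the left-invariant frame, whence
    their symmetry in [i] and [j]. They are kept as functions of x so that [pd_coord0]
    differentiates them. *)
Definition nil_gamma (k i j : 'I_3) : R -> R :=
  if k == 0 then
    if (i == 1) && (j == 1) then quad 0 (-1) 0
    else if (i == 1) && (j == 2) || (i == 2) && (j == 1) then quad 2^-1 0 0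
    else quad 0 0 0
  else if k == 1 then
    if (i == 0) && (j == 1) || (i == 1) && (j == 0) then quad 0 2^-1 0
    else if (i == 0) && (j == 2) || (i == 2) && (j == 0) then quad (- 2^-1) 0 0
    else quad 0 0 0
  else
    if (i == 0) && (j == 1) || (i == 1) && (j == 0) then quad (- 2^-1) 0 2^-1
    else if (i == 0) && (j == 2) || (i == 2) && (j == 0) then quad 0 (- 2^-1) 0
    else quad 0 0 0.

Definition nil_gq (i j : 'I_3) : R -> R :=
  if i == 0 then if j == 0 then quad 1 0 0 else quad 0 0 0
  else if i == 1 then if j == 0 then quad 0 0 0 else if j == 1 then quad 1 0 1 else quad 0 (-1) 0
  else if j == 0 then quad 0 0 0 else if j == 1 then quad 0 (-1) 0 else quad 1 0 0.

Lemma pd_nil_g k i j p :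
  pd k (fun p' => nil_g p' i j) p = if k == 0 then 'D_1 (nil_gq i j) (p 0 0) else 0.
Proof.
rewrite -pd_coord0; congr pd; apply/funext => p'; rewrite nil_gE.
by move: i j; apply: ord3P; apply: ord3P; rewrite /nil_gq /quad /=; ring.
Qed.

Lemma christoffel_nil_g k i j p :
  christoffel nil_g k i j p = nil_gamma k i j (p 0 0).
Proof.
rewrite /christoffel sum_ord3 !pd_nil_g !invmx_nil_gE.
by move: k i j; apply: ord3P; apply: ord3P; apply: ord3P;
  rewrite /nil_gamma /nil_gq /= ?derive_quad /quad; field.
Qed.

Definition nil_riemann (l i j k : 'I_3) (x : R) : R :=
  (if i == 0 then 'D_1 (nil_gamma l j k) x else 0) -
  (if j == 0 then 'D_1 (nil_gamma l i k) x else 0) +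
  \sum_m (nil_gamma l i m x * nil_gamma m j k x - nil_gamma l j m x * nil_gamma m i k x).

Lemma riemann_nil_g l i j k p :
  riemann nil_g l i j k p = nil_riemann l i j k (p 0 0).
Proof.
have E a b c : christoffel nil_g a b c = fun p => nil_gamma a b c (p 0 0).
  by apply/funext => p'; exact: christoffel_nil_g.
by rewrite /riemann !E !pd_coord0 /nil_riemann; congr (_ + _); apply: eq_bigr => m _; rewrite !E.
Qed.

(** The form dz - x dy, that is, the e_3-component of [v] translated to the Lie algebra. *)
Definition lie3 p v : R := v 0 2 - p 0 0 * v 0 1.

(** In the left-invariant frame the coordinate planes e_1 e_2, e_1 e_3, e_2 e_3 diagonalize the
    curvature, with sectional curvatures -3/4, 1/4, 1/4. The numbers [c12], [c13], [c23] are the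
    components of v ^ w, and [X1], [X2], [X3] those of R(v, w)w; the summand with [p 0 0] leads back
    from the frame to coordinates. *)
Lemma curvature_nil_g p v w l :
  let c12 := v 0 0 * w 0 1 - v 0 1 * w 0 0 in
  let c13 := v 0 0 * lie3 p w - lie3 p v * w 0 0 in
  let c23 := v 0 1 * lie3 p w - lie3 p v * w 0 1 in
  let X1 := 4^-1 * (- 3 * c12 * w 0 1 + c13 * lie3 p w) in
  let X2 := 4^-1 * (3 * c12 * w 0 0 + c23 * lie3 p w) in
  let X3 := - 4^-1 * (c13 * w 0 0 + c23 * w 0 1) in
  curvature nil_g p v w w 0 l =
  if l == 0 then X1 else if l == 1 then X2 else X3 + p 0 0 * X2.
Proof.
rewrite /= mxE.
under eq_bigr => i _ do under eq_bigr => j _ do under eq_bigr => k _ do rewrite riemann_nil_g.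
rewrite !sum_ord3 /lie3.
move: (p 0 0) (v 0 0) (v 0 1) (v 0 2) (w 0 0) (w 0 1) (w 0 2) => x a b c d e f.
rewrite /nil_riemann !sum_ord3.
by move: l; apply: ord3P; rewrite /nil_gamma /= !derive_quad /quad; field.
Qed.

(** The e_3-component of the cross product in the left-invariant frame, whose first two components
    agree with the coordinate ones. *)
Definition cross3 v w : R := v 0 0 * w 0 1 - v 0 1 * w 0 0.

(** With c12, c13, c23 the frame components of v ^ w, the numerator is (- 3 c12^2 + c13^2 + c23^2) /
    4, and Lagrange's identity gives A = c12^2 + c13^2 + c23^2. The quotient is then 1/4 - c12^2 /
    A. *)
Lemma sectional_nil_g p v w :
  let A := nil_form p v v * nil_form p w w - nil_form p v w ^+ 2 in
  A != 0 -> sectional nil_g p v w = 4^-1 - cross3 v w ^+ 2 / A.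
Proof.
move=> A A0; rewrite /sectional !metric_nil_g -/A.
suff -> : nil_form p (curvature nil_g p v w w) v = A / 4 - cross3 v w ^+ 2.
  by field.
by rewrite {1}/nil_form !curvature_nil_g /= /A /nil_form /cross3 /lie3; field.
Qed.

End Metric.
End NilAlgebra.

(** * Charts and transition maps *)

Section Charts.
Context {R : realType} {M : topologicalType}.
Implicit Types (c a : chart R M) (g : M -> R) (p : M) (q : plane R).

Definition rep g c q : R := g (chart_inv c q).

Lemma chart_im_map c p : chart_dom c p -> chart_im c (chart_map c p).
Proof. by move=> cp; exists p. Qed.

Lemma chart_im_inv c q : chart_im c q ->
  chart_dom c (chart_inv c q) /\ chart_map c (chart_inv c q) = q.
Proof. by move=> [p cp <-]; rewrite (chart_mapK cp). Qed.

Lemma near_chart_im c q : chart_im c q -> \forall q' \near q, chart_im c q'.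
Proof. by move=> cq; apply: open_nbhs_nbhs; split => //; exact: chart_im_open. Qed.

Lemma near_chart_dom c p : chart_dom c p -> \forall p' \near p, chart_dom c p'.
Proof. by move=> cq; apply: open_nbhs_nbhs; split => //; exact: chart_dom_open. Qed.

Lemma near_chart_inv c p (A : set M) : chart_dom c p ->
  nbhs p A -> \forall q \near chart_map c p, A (chart_inv c q).
Proof.
move=> cp pA; have := chart_inv_cont (chart_im_map cp).
by rewrite /prop_for /continuous_at (chart_mapK cp); apply.
Qed.

Lemma trans_dom_open c a : open (trans_dom c a).
Proof.
rewrite openE => q [p [cp ap] <-].
have n1 := near_chart_inv cp (near_chart_dom cp).
have n2 := near_chart_inv cp (near_chart_dom ap).
have n3 := near_chart_im (chart_im_map cp).
rewrite /interior /=; apply: filterS3 n1 n2 n3 => q' cp' ap' cq'.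
by exists (chart_inv c q') => //; case: (chart_im_inv cq').
Qed.

Lemma trans_domP c a q : trans_dom c a q ->
  chart_map c (chart_inv c q) = q /\ chart_inv a (trans1 c a q, trans2 c a q) = chart_inv c q.
Proof.
move=> [p [cp ap] <-]; rewrite /trans1 /trans2 (chart_mapK cp).
by rewrite -surjective_pairing (chart_mapK ap).
Qed.

(* The chain rule at [p], with a Jacobian of positive determinant. *)
Definition jac_rel c a p : Prop := exists x1 x2 y1 y2 : R,
  0 < x1 * y2 - x2 * y1 /\
  forall g, C1at (rep g a) (chart_map a p) ->
    [/\ C1at (rep g c) (chart_map c p),
        'D_ex (rep g c) (chart_map c p) =
          x1 * 'D_ex (rep g a) (chart_map a p) + x2 * 'D_ey (rep g a) (chart_map a p) &
        'D_ey (rep g c) (chart_map c p) =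
          y1 * 'D_ex (rep g a) (chart_map a p) + y2 * 'D_ey (rep g a) (chart_map a p)].

(** Near the point [rep g c] is [rep g a] composed with the transition map, so the four numbers are
    the partial derivatives of that map. *)
Lemma oriented_transition_jac c a p : oriented_transition c a ->
  chart_dom c p -> chart_dom a p -> jac_rel c a p.
Proof.
move=> [s1 s2 det] cp ap.
have td : trans_dom c a (chart_map c p) by exists p.
have c1 := Ck1_C1at (trans_dom_open (c := c) (a := a)) (s1 1%N) td.
have c2 := Ck1_C1at (trans_dom_open (c := c) (a := a)) (s2 1%N) td.
exists ('D_ex (trans1 c a) (chart_map c p)), ('D_ex (trans2 c a) (chart_map c p)),
  ('D_ey (trans1 c a) (chart_map c p)), ('D_ey (trans2 c a) (chart_map c p)).
split.
  by have := det _ td; rewrite [X in _ - X]mulrC.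
move=> g cg.
have tE : (trans1 c a (chart_map c p), trans2 c a (chart_map c p)) = chart_map a p.
  by rewrite /trans1 /trans2 (chart_mapK cp) -surjective_pairing.
have E : \forall q \near chart_map c p, rep g a (trans1 c a q, trans2 c a q) = rep g c q.
  have : \forall q \near chart_map c p, trans_dom c a q.
    by apply: open_nbhs_nbhs; split => //; exact: trans_dom_open.
  by apply: filterS => q /trans_domP[_ Eq]; rewrite /rep Eq.
rewrite -tE in cg; have cc := C1at_comp2 c1 c2 cg.
have dd v := derive_comp2 v (C1at_differentiable c1) (C1at_differentiable c2)
  (C1at_differentiable cg).
split.
- exact: C1at_near_eq E cc.
- by rewrite -(near_eq_derive _ E) dd tE; congr (_ + _); exact: mulrC.
- by rewrite -(near_eq_derive _ E) dd tE; congr (_ + _); exact: mulrC.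
Qed.

Lemma jac_rel_trans c b a p : jac_rel c b p -> jac_rel b a p -> jac_rel c a p.
Proof.
move=> [x1 [x2 [y1 [y2 [d1 H1]]]]] [s1 [s2 [t1 [t2 [d2 H2]]]]].
exists (x1 * s1 + x2 * t1), (x1 * s2 + x2 * t2), (y1 * s1 + y2 * t1), (y1 * s2 + y2 * t2).
split.
  rewrite (_ : _ - _ = (x1 * y2 - x2 * y1) * (s1 * t2 - s2 * t1)); last by ring.
  exact: mulr_gt0.
move=> g /H2[/H1[cg Ex Ey] Ex' Ey']; split => //.
- by rewrite Ex Ex' Ey'; ring.
- by rewrite Ey Ex' Ey'; ring.
Qed.

End Charts.

Section OrientedCharts.
Context {R : realType} {M : closed_oriented_surface R}.

(** [oriented_chart] compares a chart with the atlas only. The two charts are related through an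
    atlas chart around [p], and the Jacobians multiply. *)
Lemma oriented_chart_jac (c a : chart R M) p : oriented_chart c -> oriented_chart a ->
  chart_dom c p -> chart_dom a p -> jac_rel c a p.
Proof.
move=> oc oa cp ap; have [b ab bp] := surface_cover p.
have [_ cb] := oc b ab; have [ba _] := oa b ab.
apply: (jac_rel_trans (b := b)); exact: oriented_transition_jac.
Qed.

Lemma atlas_oriented_chart (a : chart R M) : surface_atlas a -> oriented_chart a.
Proof. by move=> aa b ab; split; exact: surface_oriented. Qed.

End OrientedCharts.

(** * Complex and real components of an immersion *)

Section ComplexParts.
Context {R : realType}.
Implicit Types z w : R[i].

Lemma eq_complexP z w : complex.Re z = complex.Re w -> complex.Im z = complex.Im w -> z = w.
Proof. by case: z w => [a b] [a' b'] /= -> ->. Qed.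

Lemma cReM z w : complex.Re (z * w) = complex.Re z * complex.Re w - complex.Im z * complex.Im w.
Proof. by case: z w => [a b] [a' b']. Qed.

Lemma cImM z w : complex.Im (z * w) = complex.Re z * complex.Im w + complex.Im z * complex.Re w.
Proof. by case: z w => [a b] [a' b']. Qed.

Lemma cReD z w : complex.Re (z + w) = complex.Re z + complex.Re w.
Proof. by case: z w => [a b] [a' b']. Qed.
Lemma cImD z w : complex.Im (z + w) = complex.Im z + complex.Im w.
Proof. by case: z w => [a b] [a' b']. Qed.
Lemma cReN z : complex.Re (- z) = - complex.Re z.
Proof. by case: z. Qed.
Lemma cImN z : complex.Im (- z) = - complex.Im z.
Proof. by case: z. Qed.
Lemma cReConj z : complex.Re z^* = complex.Re z.
Proof. by case: z. Qed.
Lemma cImConj z : complex.Im z^* = - complex.Im z.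
Proof. by case: z. Qed.
Lemma cReC (a : R) : complex.Re a%:C = a. Proof. by []. Qed.
Lemma cImC (a : R) : complex.Im a%:C = 0. Proof. by []. Qed.
Lemma cReI : complex.Re ('i : R[i]) = 0. Proof. by []. Qed.
Lemma cImI : complex.Im ('i : R[i]) = 1. Proof. by []. Qed.
Lemma two_inv : (2^-1 : R[i]) = (2^-1)%:C.
Proof. by rewrite -[2%:R in LHS](rmorph_nat (real_complex R)) -fmorphV. Qed.
Lemma four_inv : (4^-1 : R[i]) = (4^-1)%:C.
Proof. by rewrite -[4%:R in LHS](rmorph_nat (real_complex R)) -fmorphV. Qed.
Lemma cRenat n : complex.Re (n%:R : R[i]) = n%:R.
Proof. by rewrite -(rmorph_nat (real_complex R)). Qed.
Lemma cImnat n : complex.Im (n%:R : R[i]) = 0.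
Proof. by rewrite -(rmorph_nat (real_complex R)). Qed.
Lemma cRe1 : complex.Re (1 : R[i]) = 1. Proof. by []. Qed.
Lemma cIm1 : complex.Im (1 : R[i]) = 0. Proof. by []. Qed.

Lemma cReE (a b : R) : complex.Re (a +i* b) = a. Proof. by []. Qed.
Lemma cImE (a b : R) : complex.Im (a +i* b) = b. Proof. by []. Qed.

Definition reim := (cReE, cImE, two_inv, four_inv, cReM, cImM, cReD, cImD, cReN, cImN,
  cReConj, cImConj, cReC, cImC, cReI, cImI, cRenat, cImnat, cRe1, cIm1).

Lemma normC_sq z : `|z| ^+ 2 = (complex.Re z ^+ 2 + complex.Im z ^+ 2)%:C.
Proof.
by case: z => a b; rewrite normc_def /= -rmorphXn /= sqr_sqrtr// addr_ge0// sqr_ge0.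
Qed.

Lemma dz_alg (a b : R) : (a%:C - 'i * b%:C) / 2 = (a / 2) +i* (- b / 2).
Proof. by apply: eq_complexP; rewrite !reim; ring. Qed.

Lemma dzbar_alg (a b : R) : (a%:C + 'i * b%:C) / 2 = (a / 2) +i* (b / 2).
Proof. by apply: eq_complexP; rewrite !reim; ring. Qed.

Lemma cderive_real (h : plane R -> R[i]) (k : plane R -> R) v q :
  (forall p, h p = (k p)%:C) -> cderive v h q = ('D_v k q)%:C.
Proof.
move=> hk; rewrite /cderive.
have -> : (fun p => complex.Re (h p)) = k by apply/funext => p; rewrite hk.
have -> : (fun p => complex.Im (h p)) = fun=> 0 by apply/funext => p; rewrite hk.
by have -> : 'D_v (fun _ : plane R => 0 : R) q = 0 by exact: derive_cst.
Qed.

Lemma dz_real (h : plane R -> R[i]) (k : plane R -> R) q :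
  (forall p, h p = (k p)%:C) -> dz h q = ('D_ex k q / 2) +i* (- 'D_ey k q / 2).
Proof.
by move=> hk; rewrite /dz !(cderive_real _ _ hk); exact: dz_alg.
Qed.

Lemma dzbar_real (h : plane R -> R[i]) (k : plane R -> R) q :
  (forall p, h p = (k p)%:C) -> dzbar h q = ('D_ex k q / 2) +i* ('D_ey k q / 2).
Proof.
by move=> hk; rewrite /dzbar !(cderive_real _ _ hk); exact: dzbar_alg.
Qed.

Lemma Re_dzbar_alg (z w : R[i]) (a b : R) :
  complex.Re z = 2^-1 * a -> complex.Im w = - 2^-1 * b ->
  complex.Re ((z + 'i * w) / 2) = (a + b) / 4.
Proof. by move=> za wb; rewrite !reim za wb; field. Qed.

(** Here [h] is (k1 - i k2) / 2, the shape of f_z. When [k1] and [k2] are the partial derivatives of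
    one function, the result is a quarter of its Laplacian. *)
Lemma Re_dzbar (h : plane R -> R[i]) (k1 k2 : plane R -> R) q :
  (forall p, complex.Re (h p) = k1 p / 2) -> (forall p, complex.Im (h p) = - k2 p / 2) ->
  derivable k1 q ex -> derivable k2 q ey ->
  complex.Re (dzbar h q) = ('D_ex k1 q + 'D_ey k2 q) / 4.
Proof.
move=> h1 h2 d1 d2.
have e1 : 'D_ex (fun p => complex.Re (h p)) q = 2^-1 * 'D_ex k1 q.
  have -> : (fun p => complex.Re (h p)) = 2^-1 \*: k1 by apply/funext => p; rewrite h1 mulrC.
  by rewrite deriveZ.
have e2 : 'D_ey (fun p => complex.Im (h p)) q = - 2^-1 * 'D_ey k2 q.
  have -> : (fun p => complex.Im (h p)) = (- 2^-1) \*: k2.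
    by apply/funext => p; rewrite h2 /= mulNr [RHS]mulNr mulrC.
  by rewrite deriveZ.
exact: (@Re_dzbar_alg (cderive ex h q) (cderive ey h q) _ _ e1 e2).
Qed.

End ComplexParts.

Section Frame.
Context {R : realType} {M : closed_oriented_surface R}.
Implicit Types (f : M -> 'rV[R]_3) (c : chart R M) (q : plane R) (k : 'I_3).

Definition coordf f k : M -> R := fun m => f m 0 k.

(* The [e_k]-components of [f^-1 f_x] and [f^-1 f_y]: the paper's [Z_k] is
   [(liex f c k - i liey f c k) / 2]. *)
Definition liex f c k q : R := left_to_lie (local_map f c q) (local_derive ex f c q) 0 k.
Definition liey f c k q : R := left_to_lie (local_map f c q) (local_derive ey f c q) 0 k.

Lemma liexE f c k q : liex f c k q =
  if k == 2 then 'D_ex (rep (coordf f 2) c) q - rep (coordf f 0) c q * 'D_ex (rep (coordf f 1) c) q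
  else 'D_ex (rep (coordf f k) c) q.
Proof. by rewrite /liex left_to_lieE !mxE. Qed.

Lemma lieyE f c k q : liey f c k q =
  if k == 2 then 'D_ey (rep (coordf f 2) c) q - rep (coordf f 0) c q * 'D_ey (rep (coordf f 1) c) q
  else 'D_ey (rep (coordf f k) c) q.
Proof. by rewrite /liey left_to_lieE !mxE. Qed.

Lemma f_zE f c q k : f_z f c q 0 k =
  ('D_ex (rep (coordf f k) c) q / 2) +i* (- 'D_ey (rep (coordf f k) c) q / 2).
Proof.
rewrite mxE; apply: (@dz_real _ _ (rep (coordf f k) c)) => p.
by rewrite /clocal_map mxE.
Qed.

Lemma f_zbarE f c q k : f_zbar f c q 0 k =
  ('D_ex (rep (coordf f k) c) q / 2) +i* ('D_ey (rep (coordf f k) c) q / 2).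
Proof.
rewrite mxE; apply: (@dzbar_real _ _ (rep (coordf f k) c)) => p.
by rewrite /clocal_map mxE.
Qed.

Lemma lie_half_alg (a b u v x : R) :
  (a / 2 +i* (- b / 2)) - x%:C * (u / 2 +i* (- v / 2)) =
  ((a - x * u) / 2) +i* (- (b - x * v) / 2).
Proof. by apply: eq_complexP; rewrite !reim; ring. Qed.

Lemma ZvecE f c q k : Zvec f c q 0 k = (liex f c k q / 2) +i* (- liey f c k q / 2).
Proof.
rewrite /Zvec left_to_lieE liexE lieyE !f_zE.
case: (k == 2) => //; rewrite {1}/clocal_map mxE; exact: lie_half_alg.
Qed.

Lemma half_components (x y : R) (z : R[i]) : z = (x / 2) +i* (- y / 2) ->
  x = 2 * complex.Re z /\ y = - 2 * complex.Im z.
Proof. by move=> ->; split; rewrite !reim; field. Qed.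

(** The frame is a quadratic polynomial in the real components of the spinor. This gives its
    regularity in [spinor_C1at] and the identities behind UV in [spinor_factor]. *)
Lemma spinor_frame f c psi1 psi2 q : generating_spinor f c psi1 psi2 -> chart_im c q ->
  let a1 := complex.Re (psi1 q) in let b1 := complex.Im (psi1 q) in
  let a2 := complex.Re (psi2 q) in let b2 := complex.Im (psi2 q) in
  [/\ liex f c 0 q = 2 * (a2 * b2 - a1 * b1),
      liex f c 1 q = a2 * a2 - b2 * b2 - a1 * a1 + b1 * b1 &
      liex f c 2 q = 2 * (a1 * a2 + b1 * b2)] /\
  [/\ liey f c 0 q = - (a2 * a2 - b2 * b2 + a1 * a1 - b1 * b1),
      liey f c 1 q = 2 * (a2 * b2 + a1 * b1) &
      liey f c 2 q = - (2 * (b1 * a2 - a1 * b2))].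
Proof.
move=> [_ _ gs] cq /=; have [Z0 Z1 Z2] := gs q cq.
have [-> ->] := half_components (esym (etrans (esym (ZvecE f c q 0)) Z0)).
have [-> ->] := half_components (esym (etrans (esym (ZvecE f c q 1)) Z1)).
have [-> ->] := half_components (esym (etrans (esym (ZvecE f c q 2)) Z2)).
rewrite !expr2; move: (psi1 q) (psi2 q) => s1 s2.
by split; split; rewrite !reim; field.
Qed.

End Frame.

Section FrameEquations.
Context {R : realType} {M : closed_oriented_surface R}.
Implicit Types (f : M -> 'rV[R]_3) (c : chart R M) (q : plane R) (k : 'I_3).

Lemma nil_form_lie (p v w : 'rV[R]_3) : nil_form p v w =
  left_to_lie p v 0 0 * left_to_lie p w 0 0 + left_to_lie p v 0 1 * left_to_lie p w 0 1 +
  left_to_lie p v 0 2 * left_to_lie p w 0 2.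
Proof. by rewrite !left_to_lieE. Qed.

Lemma induced_form_lie f c q : 
  [/\ induced_form f c q ex ex = liex f c 0 q ^+ 2 + liex f c 1 q ^+ 2 + liex f c 2 q ^+ 2,
      induced_form f c q ey ey = liey f c 0 q ^+ 2 + liey f c 1 q ^+ 2 + liey f c 2 q ^+ 2 &
      induced_form f c q ex ey = liex f c 0 q * liey f c 0 q + liex f c 1 q * liey f c 1 q
        + liex f c 2 q * liey f c 2 q].
Proof.
by split; rewrite /induced_form metric_nil_g nil_form_lie ?expr2.
Qed.

Lemma spinor_C1at f c psi1 psi2 q k : generating_spinor f c psi1 psi2 -> chart_im c q ->
  C1at (liex f c k) q /\ C1at (liey f c k) q.
Proof.
move=> gs cq; have [[s1r s1i] [s2r s2i] _] := gs.
have oD := chart_im_open (c := c).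
have A1 := Ck1_C1at oD (s1r 1%N) cq; have B1 := Ck1_C1at oD (s1i 1%N) cq.
have A2 := Ck1_C1at oD (s2r 1%N) cq; have B2 := Ck1_C1at oD (s2i 1%N) cq.
have nr (g h : plane R -> R) : (forall p, chart_im c p -> h p = g p) -> C1at h q -> C1at g q.
  by move=> gh; apply: C1at_near_eq; apply: filterS (near_chart_im cq) => p; exact: gh.
have two h : C1at h q -> C1at (fun p => 2 * h p) q by exact: C1atZ.
split; move: k; apply: ord3P.
- apply: (nr _ _ _ (two _ (C1atB (C1atM A2 B2) (C1atM A1 B1)))).
  by move=> p /(spinor_frame gs)[[e _ _] _]; rewrite e.
- apply: (nr _ _ _ (C1atD (C1atB (C1atB (C1atM A2 A2) (C1atM B2 B2)) (C1atM A1 A1)) (C1atM B1 B1))).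
  by move=> p /(spinor_frame gs)[[_ e _] _]; rewrite e.
- apply: (nr _ _ _ (two _ (C1atD (C1atM A1 A2) (C1atM B1 B2)))).
  by move=> p /(spinor_frame gs)[[_ _ e] _]; rewrite e.
- apply: (nr _ _ _ (C1atN (C1atB (C1atD (C1atB (C1atM A2 A2) (C1atM B2 B2)) (C1atM A1 A1)) (C1atM B1 B1)))).
  by move=> p /(spinor_frame gs)[_ [e _ _]]; rewrite e.
- apply: (nr _ _ _ (two _ (C1atD (C1atM A2 B2) (C1atM A1 B1)))).
  by move=> p /(spinor_frame gs)[_ [_ e _]]; rewrite e.
- apply: (nr _ _ _ (C1atN (two _ (C1atB (C1atM B1 A2) (C1atM A1 B2))))).
  by move=> p /(spinor_frame gs)[_ [_ _ e]]; rewrite e.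
Qed.

Lemma coordf_C1at f c q k : immersion f -> oriented_chart c -> chart_im c q ->
  C1at (rep (coordf f k) c) q.
Proof.
move=> hf oc cq; have [cp <-] := chart_im_inv cq; move: (chart_inv c q) cp => p cp.
have [a aa ap] := surface_cover p.
have [x1 [x2 [y1 [y2 [_ H]]]]] := oriented_chart_jac oc (atlas_oriented_chart aa) cp ap.
suff cg : C1at (rep (coordf f k) a) (chart_map a p) by have [cc _ _] := H _ cg.
by have [sm _] := hf a aa; exact: Ck1_C1at (chart_im_open (c := a)) (sm k 1%N) (chart_im_map ap).
Qed.

(* The real part of [4 nabla_{f_zbar} f_z]. *)
Definition nabla_re f c k q : R :=
  'D_ex ('D_ex (rep (coordf f k) c)) q + 'D_ey ('D_ey (rep (coordf f k) c)) q +
    \sum_i \sum_l christoffel nil_g k i l (local_map f c q) *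
      ('D_ex (rep (coordf f i) c) q * 'D_ex (rep (coordf f l) c) q +
       'D_ey (rep (coordf f i) c) q * 'D_ey (rep (coordf f l) c) q).

(* Frame components of the real part of [nabla_{f_zbar} f_z]. *)
Definition liew f c k q : R :=
  (if k == 2 then nabla_re f c 2 q - rep (coordf f 0) c q * nabla_re f c 1 q
   else nabla_re f c k q) / 4.

(* The components of [f^-1 N]: the cross product of [f^-1 f_x] and [f^-1 f_y] over [e^(2 alpha)]. *)
Definition lien f c k q : R :=
  (if k == 0 then liex f c 1 q * liey f c 2 q - liex f c 2 q * liey f c 1 q
   else if k == 1 then liex f c 2 q * liey f c 0 q - liex f c 0 q * liey f c 2 q
   else liex f c 0 q * liey f c 1 q - liex f c 1 q * liey f c 0 q) / conformal_factor f c q.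

(** The bracket is a number minus its conjugate, hence imaginary; the factor 2i turns it into a real
    coefficient of the cross product. *)
Lemma cross_alg (a b u v l : R) :
  2 * 'i * (l^-1)%:C * (((a / 2) +i* (- b / 2))^* * ((u / 2) +i* (- v / 2)) -
    ((a / 2) +i* (- b / 2)) * ((u / 2) +i* (- v / 2))^*) = ((a * v - u * b) / l)%:C.
Proof. by move: (l^-1) => m; apply: eq_complexP; rewrite !reim; field. Qed.

Lemma normal_lieE f c q k : normal_lie f c q 0 k = (lien f c k q)%:C.
Proof.
rewrite /normal_lie /lien; cbv zeta; rewrite [LHS]mxE [X in _ * X]mxE !ZvecE.
by move: k; apply: ord3P; exact: cross_alg.
Qed.

Lemma unit_normalE f c q k : unit_normal f c q 0 k =
  (if k == 2 then lien f c 2 q + rep (coordf f 0) c q * lien f c 1 q else lien f c k q)%:C.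
Proof.
rewrite /unit_normal left_from_lieE !normal_lieE.
case: (k == 2) => //; rewrite /clocal_map mxE -rmorphM -rmorphD; congr (_%:C); ring.
Qed.

End FrameEquations.

(** * The mean curvature equation in the left-invariant frame *)

Section MeanCurvature.
Context {R : realType} {M : closed_oriented_surface R}.
Variables (f : M -> 'rV[R]_3) (c : chart R M) (psi1 psi2 : plane R -> R[i]) (q : plane R).
Hypotheses (hf : immersion f) (conf : conformal_parameter f c).
Hypotheses (gs : generating_spinor f c psi1 psi2) (cq : chart_im c q).

Local Notation F k := (rep (coordf f k) c).

(** The frame is C^1 thanks to the spinor. For two coordinates the frame component is the partial
    derivative itself; the third is recovered from X_3 by adding x times the derivative of y. *)
Lemma derive_ex_coordf_C1at k : C1at ('D_ex (F k)) q.
Proof.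
have X k' := (spinor_C1at k' gs cq).1; have F0 := coordf_C1at 0 hf conf.1 cq.
have E k' : (k' == 2) = false -> C1at ('D_ex (F k')) q.
  move=> k2; rewrite (_ : 'D_ex _ = liex f c k'); first exact: X.
  by apply/funext => p; rewrite liexE k2.
move: k; apply: ord3P; [exact: E|exact: E|].
rewrite (_ : 'D_ex _ = fun p => liex f c 2 p + F 0 p * 'D_ex (F 1) p).
  exact: (C1atD (X 2) (C1atM F0 (E 1 erefl))).
by apply/funext => p; rewrite liexE /= subrK.
Qed.

Lemma derive_ey_coordf_C1at k : C1at ('D_ey (F k)) q.
Proof.
have Y k' := (spinor_C1at k' gs cq).2; have F0 := coordf_C1at 0 hf conf.1 cq.
have E k' : (k' == 2) = false -> C1at ('D_ey (F k')) q.
  move=> k2; rewrite (_ : 'D_ey _ = liey f c k'); first exact: Y.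
  by apply/funext => p; rewrite lieyE k2.
move: k; apply: ord3P; [exact: E|exact: E|].
rewrite (_ : 'D_ey _ = fun p => liey f c 2 p + F 0 p * 'D_ey (F 1) p).
  exact: (C1atD (Y 2) (C1atM F0 (E 1 erefl))).
by apply/funext => p; rewrite lieyE /= subrK.
Qed.

Lemma christoffel_term_alg (g a b u v : R) :
  complex.Re (g%:C * ((a / 2) +i* (b / 2)) * ((u / 2) +i* (- v / 2))) = g * (a * u + b * v) / 4.
Proof. by rewrite !reim; field. Qed.

Lemma Re_sum3 (g : 'I_3 -> R[i]) : complex.Re (\sum_i g i) = \sum_i complex.Re (g i).
Proof. by rewrite !sum_ord3 !cReD. Qed.

Lemma Re_nabla k : complex.Re (nabla_zbar_z f c q 0 k) = nabla_re f c k q / 4.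
Proof.
rewrite mxE cReD (@Re_dzbar _ _ ('D_ex (F k)) ('D_ey (F k))); last 4 first.
- by move=> p; rewrite f_zE.
- by move=> p; rewrite f_zE.
- exact: C1at_derivable (derive_ex_coordf_C1at k).
- exact: C1at_derivable (derive_ey_coordf_C1at k).
rewrite [RHS]mulrDl; congr (_ + _).
rewrite mulr_suml Re_sum3; apply: eq_bigr => i _.
rewrite mulr_suml Re_sum3; apply: eq_bigr => l _.
by rewrite f_zE f_zbarE; exact: christoffel_term_alg.
Qed.

Lemma liew_alg (n n1 x u v l h : R) : n / 4 = 2^-1 * l * h * (u + x * v) ->
  n1 / 4 = 2^-1 * l * h * v -> (n - x * n1) / 4 = l * h / 2 * u.
Proof.
move=> e1 e2; rewrite (_ : _ / 4 = n / 4 - x * (n1 / 4)); last by ring.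
by rewrite e1 e2; ring.
Qed.

(** The given equation is in coordinates. Subtracting x times the y-component from the z-component
    brings it to the frame, where the normal has components [lien]. *)
Lemma mean_curvature_frame (H : M -> R) k : is_mean_curvature f H ->
  liew f c k q = conformal_factor f c q * H (chart_inv c q) / 2 * lien f c k q.
Proof.
move=> hH; have E j := congr1 (fun A : 'rV_3 => complex.Re (A 0 j)) (hH c conf q cq).
have {}E j : nabla_re f c j q / 4 = 2^-1 * conformal_factor f c q * H (chart_inv c q) *
    (if j == 2 then lien f c 2 q + F 0 q * lien f c 1 q else lien f c j q).
  by rewrite -Re_nabla E mxE unit_normalE -rmorphM.
rewrite /liew; case: (eqVneq k 2) => [->|k2].
  exact: (liew_alg (E 2) (E 1)).
rewrite E (negbTE k2).
by move: (conformal_factor f c q) (H _) (lien _ _ _ _) => l h u; ring.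
Qed.

(** Contracted with dz - x dy, the Christoffel symbols leave only -1/2 (dx dy + dy dx). In [liew2E]
    this is exactly the term that arises when X_3 and Y_3 are differentiated and the derivative
    falls on the coefficient x. *)
Lemma nil_gamma_sum (A : 'I_3 -> 'I_3 -> R) x :
  \sum_i \sum_l nil_gamma 2 i l x * A i l - x * (\sum_i \sum_l nil_gamma 1 i l x * A i l) =
  - 2^-1 * (A 0 1 + A 1 0).
Proof. by rewrite !sum_ord3 /nil_gamma /= /quad; field. Qed.

Lemma liew2_alg (X2 Y2 S2 X1 Y1 S1 x a b u v : R) :
  S2 - x * S1 = - 2^-1 * ((a * b + u * v) + (b * a + v * u)) ->
  (X2 + Y2 + S2 - x * (X1 + Y1 + S1)) / 4 =
  (X2 - (x * X1 + b * a) + (Y2 - (x * Y1 + v * u))) / 4.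
Proof.
move=> E; rewrite (_ : X2 + _ + _ - _ = X2 + Y2 - x * (X1 + Y1) + (S2 - x * S1)); last by ring.
by rewrite E; field.
Qed.

Lemma liew2E : liew f c 2 q = ('D_ex (liex f c 2) q + 'D_ey (liey f c 2) q) / 4.
Proof.
have dX k v : derivable ('D_ex (F k)) q v := C1at_derivable (derive_ex_coordf_C1at k).
have dY k v : derivable ('D_ey (F k)) q v := C1at_derivable (derive_ey_coordf_C1at k).
have dF k v : derivable (F k) q v := C1at_derivable (coordf_C1at k hf conf.1 cq).
have EX : 'D_ex (liex f c 2) q = 'D_ex ('D_ex (F 2)) q -
    (F 0 q * 'D_ex ('D_ex (F 1)) q + 'D_ex (F 1) q * 'D_ex (F 0) q).
  have -> : liex f c 2 = 'D_ex (F 2) - F 0 * 'D_ex (F 1).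
    by apply/funext => p; rewrite liexE.
  rewrite deriveB; [|exact: dX|apply: derivableM; [exact: dF|exact: dX]].
  by rewrite deriveM; [|exact: dF|exact: dX].
have EY : 'D_ey (liey f c 2) q = 'D_ey ('D_ey (F 2)) q -
    (F 0 q * 'D_ey ('D_ey (F 1)) q + 'D_ey (F 1) q * 'D_ey (F 0) q).
  have -> : liey f c 2 = 'D_ey (F 2) - F 0 * 'D_ey (F 1).
    by apply/funext => p; rewrite lieyE.
  rewrite deriveB; [|exact: dY|apply: derivableM; [exact: dF|exact: dY]].
  by rewrite deriveM; [|exact: dF|exact: dY].
apply: etrans (esym (congr1 (fun t => t / 4) (congr2 (fun a b => a + b) EX EY))).
apply: liew2_alg.
pose A i l := 'D_ex (F i) q * 'D_ex (F l) q + 'D_ey (F i) q * 'D_ey (F l) q.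
apply: etrans (nil_gamma_sum A (F 0 q)).
by congr (_ - _ * _); apply: eq_bigr => i _; apply: eq_bigr => l _; rewrite christoffel_nil_g.
Qed.

End MeanCurvature.

(** * Conformal parameters *)

Section Pointwise.
Context {R : realType} {M : closed_oriented_surface R}.
Variables (f : M -> 'rV[R]_3) (hf : immersion f).
Implicit Types (c a : chart R M) (p : M) (q : plane R) (k : 'I_3).

Lemma jac_liex c a p x1 x2 y1 y2 :
  (forall g, C1at (rep g a) (chart_map a p) ->
    [/\ C1at (rep g c) (chart_map c p),
        'D_ex (rep g c) (chart_map c p) =
          x1 * 'D_ex (rep g a) (chart_map a p) + x2 * 'D_ey (rep g a) (chart_map a p) &
        'D_ey (rep g c) (chart_map c p) =
          y1 * 'D_ex (rep g a) (chart_map a p) + y2 * 'D_ey (rep g a) (chart_map a p)]) ->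
  oriented_chart a -> chart_dom a p -> chart_dom c p -> forall k,
  liex f c k (chart_map c p) = x1 * liex f a k (chart_map a p) + x2 * liey f a k (chart_map a p) /\
  liey f c k (chart_map c p) = y1 * liex f a k (chart_map a p) + y2 * liey f a k (chart_map a p).
Proof.
move=> J oa ap cp k; rewrite !liexE !lieyE.
have E j := J _ (coordf_C1at j hf oa (chart_im_map ap)).
have r0 : rep (coordf f 0) c (chart_map c p) = rep (coordf f 0) a (chart_map a p).
  by rewrite /rep !chart_mapK.
case: (k == 2); last by case: (E k).
have [_ -> ->] := E 2; have [_ -> ->] := E 1; rewrite r0.
move: ('D_ex _ _) ('D_ex _ _) ('D_ey _ _) ('D_ey _ _) (rep _ _ _) => A B C D x.
by split; ring.
Qed.

Lemma conformal_frame c q : conformal_parameter f c -> chart_im c q ->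
  [/\ conformal_factor f c q = liex f c 0 q ^+ 2 + liex f c 1 q ^+ 2 + liex f c 2 q ^+ 2,
      conformal_factor f c q = liey f c 0 q ^+ 2 + liey f c 1 q ^+ 2 + liey f c 2 q ^+ 2 &
      0 = liex f c 0 q * liey f c 0 q + liex f c 1 q * liey f c 1 q + liex f c 2 q * liey f c 2 q].
Proof.
move=> [_ conf] cq; have [e1 e2] := conf q cq; have [E1 E2 E3] := induced_form_lie f c q.
split; [exact: E1|exact: etrans e1 E2|exact: etrans (esym e2) E3].
Qed.

Lemma lie0_local_derive c q :
  (forall k, liex f c k q = 0) -> local_derive ex f c q = 0.
Proof.
move=> X0; apply/rowP => k; rewrite !mxE -[LHS]/('D_ex (rep (coordf f k) c) q).
have X j : (j == 2) = false -> 'D_ex (rep (coordf f j) c) q = 0.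
  by move=> j2; have := X0 j; rewrite liexE j2.
move: k; apply: ord3P; [exact: X|exact: X|].
have := X0 2; rewrite liexE eqxx (X 1)// mulr0 subr0; exact: id.
Qed.

(** The immersion condition lives in atlas charts. If f_x vanished in [c], then x1, x2 would be the
    coefficients of a linear relation between f_x and f_y in an atlas chart, hence both 0, against
    the positive determinant. *)
Lemma conformal_factor_gt0 c q : conformal_parameter f c -> chart_im c q ->
  0 < conformal_factor f c q.
Proof.
move=> conf cq; have [e _ _] := conformal_frame conf cq.
rewrite lt0r e !addr_ge0 ?sqr_ge0// andbT; apply/negP => /eqP s0.
have [cp qE] := chart_im_inv cq; move: (chart_inv c q) cp qE => p cp qE.
have [a aa ap] := surface_cover p; have oa := atlas_oriented_chart aa.
have [x1 [x2 [y1 [y2 [d H]]]]] := oriented_chart_jac conf.1 oa cp ap.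
have X0 k : liex f c k q = 0.
  apply/eqP; rewrite -sqrf_eq0; move: s0.
  have := sqr_ge0 (liex f c 0 q); have := sqr_ge0 (liex f c 1 q); have := sqr_ge0 (liex f c 2 q).
  move: k; apply: ord3P => *; rewrite eq_le sqr_ge0 andbT; lra.
have [] := (hf aa).2 _ (chart_im_map ap) x1 x2.
  apply/rowP => k; have [_ Ex _] := H _ (coordf_C1at k hf oa (chart_im_map ap)).
  rewrite mxE [X in X + _]mxE [X in _ + X]mxE [X in _ * X + _]mxE [X in _ + _ * X]mxE [RHS]mxE.
  apply: etrans (esym Ex) _; rewrite qE.
  have := congr1 (fun A : 'rV_3 => A 0 k) (lie0_local_derive X0); rewrite !mxE; exact: id.
by move=> x10 x20; move: d; rewrite x10 x20 !mul0r subrr ltxx.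
Qed.

Lemma conformal_lien c q : conformal_parameter f c -> chart_im c q ->
  lien f c 0 q ^+ 2 + lien f c 1 q ^+ 2 + lien f c 2 q ^+ 2 = 1.
Proof.
move=> conf cq; have [e1 e2 e3] := conformal_frame conf cq.
have l0 := lt0r_neq0 (conformal_factor_gt0 conf cq).
rewrite /lien /=; move: (conformal_factor f c q) (liex f c 0 q) (liex f c 1 q) (liex f c 2 q)
  (liey f c 0 q) (liey f c 1 q) (liey f c 2 q) e1 e2 e3 l0 => l a b d x y z e1 e2 e3 l0.
rewrite !expr_div_n -!mulrDl.
apply: (canLR (mulfK _)); first by rewrite expf_neq0.
have E : l ^+ 2 = (a ^+ 2 + b ^+ 2 + d ^+ 2) * (x ^+ 2 + y ^+ 2 + z ^+ 2).
  by rewrite -e1 -e2 expr2.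
rewrite mul1r E.
transitivity ((a * y - b * x) ^+ 2 + (b * z - d * y) ^+ 2 + (d * x - a * z) ^+ 2); first by ring.
(* Lagrange's identity; the inner product that it subtracts is 0 by [e3]. *)
transitivity ((a ^+ 2 + b ^+ 2 + d ^+ 2) * (x ^+ 2 + y ^+ 2 + z ^+ 2)
  - (a * x + b * y + d * z) ^+ 2); first by ring.
by rewrite -e3 expr0n subr0.
Qed.

(** The vector equation paired with the unit normal. It makes [H] an explicit expression in the
    frame, from which its continuity is deduced. *)
Lemma mean_curvature_formula (H : M -> R) c psi1 psi2 q : is_mean_curvature f H ->
  conformal_parameter f c -> generating_spinor f c psi1 psi2 -> chart_im c q ->
  H (chart_inv c q) = 2 / conformal_factor f c q *
    (lien f c 0 q * liew f c 0 q + lien f c 1 q * liew f c 1 q + lien f c 2 q * liew f c 2 q).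
Proof.
move=> hH conf gs cq; have n1 := conformal_lien conf cq.
have l0 := lt0r_neq0 (conformal_factor_gt0 conf cq).
rewrite !(mean_curvature_frame hf conf gs cq _ hH).
move: (conformal_factor f c q) (H _) (lien f c 0 q) (lien f c 1 q) (lien f c 2 q) l0 n1.
move=> l h a b d l0 n1.
transitivity (h * (a ^+ 2 + b ^+ 2 + d ^+ 2)); first by rewrite n1 mulr1.
by field.
Qed.

Lemma divergence_alg (A B l h n : R) : (A + B) / 4 = l * h / 2 * n -> A + B = 2 * l * h * n.
Proof.
move=> E; have -> : A + B = 4 * ((A + B) / 4) by field.
by rewrite E; field.
Qed.

Lemma divergence_formula (H : M -> R) c psi1 psi2 q : is_mean_curvature f H ->
  conformal_parameter f c -> generating_spinor f c psi1 psi2 -> chart_im c q ->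
  'D_ex (liex f c 2) q + 'D_ey (liey f c 2) q =
  2 * conformal_factor f c q * H (chart_inv c q) * lien f c 2 q.
Proof.
move=> hH conf gs cq; apply: divergence_alg.
exact: etrans (esym (liew2E hf conf gs cq)) (mean_curvature_frame hf conf gs cq 2 hH).
Qed.

(** A linear map between two orthogonal frames, each with vectors of equal length, is a similarity;
    the positive determinant excludes reflections. *)
Lemma frame_change_alg (a b d x y z l l' x1 x2 y1 y2 : R) :
  l' = a ^+ 2 + b ^+ 2 + d ^+ 2 -> l' = x ^+ 2 + y ^+ 2 + z ^+ 2 -> 0 = a * x + b * y + d * z ->
  l = (x1 * a + x2 * x) ^+ 2 + (x1 * b + x2 * y) ^+ 2 + (x1 * d + x2 * z) ^+ 2 ->
  l = (y1 * a + y2 * x) ^+ 2 + (y1 * b + y2 * y) ^+ 2 + (y1 * d + y2 * z) ^+ 2 ->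
  0 = (x1 * a + x2 * x) * (y1 * a + y2 * x) + (x1 * b + x2 * y) * (y1 * b + y2 * y)
    + (x1 * d + x2 * z) * (y1 * d + y2 * z) ->
  0 < l' -> 0 < x1 * y2 - x2 * y1 ->
  [/\ y1 = - x2, y2 = x1 & l = (x1 ^+ 2 + x2 ^+ 2) * l'].
Proof.
move=> e1 e2 e3 e4 e5 e6 l0 d0.
have f4 : l = (x1 ^+ 2 + x2 ^+ 2) * l'.
  transitivity (x1 ^+ 2 * (a ^+ 2 + b ^+ 2 + d ^+ 2) + x2 ^+ 2 * (x ^+ 2 + y ^+ 2 + z ^+ 2)
    + 2 * x1 * x2 * (a * x + b * y + d * z)); first by rewrite e4; ring.
  by rewrite -e1 -e2 -e3; ring.
have f5 : l = (y1 ^+ 2 + y2 ^+ 2) * l'.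
  transitivity (y1 ^+ 2 * (a ^+ 2 + b ^+ 2 + d ^+ 2) + y2 ^+ 2 * (x ^+ 2 + y ^+ 2 + z ^+ 2)
    + 2 * y1 * y2 * (a * x + b * y + d * z)); first by rewrite e5; ring.
  by rewrite -e1 -e2 -e3; ring.
have f6 : 0 = (x1 * y1 + x2 * y2) * l'.
  transitivity (x1 * y1 * (a ^+ 2 + b ^+ 2 + d ^+ 2) + x2 * y2 * (x ^+ 2 + y ^+ 2 + z ^+ 2)
    + (x1 * y2 + x2 * y1) * (a * x + b * y + d * z)); first by rewrite e6; ring.
  by rewrite -e1 -e2 -e3; ring.
have l'0 := lt0r_neq0 l0.
have g1 : x1 ^+ 2 + x2 ^+ 2 = y1 ^+ 2 + y2 ^+ 2 by apply: (mulIf l'0); rewrite -f4 -f5.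
have g2 : x1 * y1 + x2 * y2 = 0 by apply: (mulIf l'0); rewrite -f6 mul0r.
set D := x1 * y2 - x2 * y1 in d0.
(* Lagrange's identity in the plane; positivity of [D] then selects the root. *)
have g3 : D ^+ 2 = (x1 ^+ 2 + x2 ^+ 2) ^+ 2.
  transitivity ((x1 ^+ 2 + x2 ^+ 2) * (y1 ^+ 2 + y2 ^+ 2) - (x1 * y1 + x2 * y2) ^+ 2).
    by rewrite /D; ring.
  by rewrite g2 -g1; ring.
have g4 : D = x1 ^+ 2 + x2 ^+ 2.
  by apply/eqP; rewrite -(@eqrXn2 _ 2)// ?g3// ?(ltW d0)// addr_ge0 ?sqr_ge0.
(* The squares of the two Cauchy-Riemann defects add up to the squared lengths of both rows minus 2
   D, which is 0 by [g1] and [g4]. *)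
have g5 : (y2 - x1) ^+ 2 + (y1 + x2) ^+ 2 = 0.
  transitivity ((x1 ^+ 2 + x2 ^+ 2) + (y1 ^+ 2 + y2 ^+ 2) - 2 * D); first by rewrite /D; ring.
  by rewrite -g1 g4; ring.
have /andP[] : ((y2 - x1) ^+ 2 == 0) && ((y1 + x2) ^+ 2 == 0).
  by rewrite -paddr_eq0 ?sqr_ge0// g5.
rewrite !sqrf_eq0 subr_eq0 addr_eq0 => /eqP -> /eqP ->; split => //.
Qed.

Lemma sum_sqr_congr (a b d a' b' d' : R) : a = a' -> b = b' -> d = d' ->
  a ^+ 2 + b ^+ 2 + d ^+ 2 = a' ^+ 2 + b' ^+ 2 + d' ^+ 2.
Proof. by move=> -> -> ->. Qed.

Lemma dot_congr (a b d x y z a' b' d' x' y' z' : R) :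
  a = a' -> b = b' -> d = d' -> x = x' -> y = y' -> z = z' ->
  a * x + b * y + d * z = a' * x' + b' * y' + d' * z'.
Proof. by move=> -> -> -> -> -> ->. Qed.

(* Two conformal parameters are related by a Cauchy-Riemann Jacobian. *)
Lemma conformal_jac c a p : conformal_parameter f c -> conformal_parameter f a ->
  chart_dom c p -> chart_dom a p ->
  exists x1 x2 : R, [/\ x1 ^+ 2 + x2 ^+ 2 != 0,
    conformal_factor f c (chart_map c p) =
      (x1 ^+ 2 + x2 ^+ 2) * conformal_factor f a (chart_map a p),
    (forall k,
      liex f c k (chart_map c p) =
        x1 * liex f a k (chart_map a p) + x2 * liey f a k (chart_map a p) /\
      liey f c k (chart_map c p) =
        - x2 * liex f a k (chart_map a p) + x1 * liey f a k (chart_map a p)) &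
    forall g, C1at (rep g a) (chart_map a p) ->
    [/\ C1at (rep g c) (chart_map c p),
        'D_ex (rep g c) (chart_map c p) =
          x1 * 'D_ex (rep g a) (chart_map a p) + x2 * 'D_ey (rep g a) (chart_map a p) &
        'D_ey (rep g c) (chart_map c p) =
          - x2 * 'D_ex (rep g a) (chart_map a p) + x1 * 'D_ey (rep g a) (chart_map a p)]].
Proof.
move=> cc ca cp ap; have [x1 [x2 [y1 [y2 [d J]]]]] := oriented_chart_jac cc.1 ca.1 cp ap.
have L := jac_liex J ca.1 ap cp.
have [e1 e2 e3] := conformal_frame ca (chart_im_map ap).
have [e4 e5 e6] := conformal_frame cc (chart_im_map cp).
have l0 := conformal_factor_gt0 ca (chart_im_map ap).
have l0' := conformal_factor_gt0 cc (chart_im_map cp).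
have E k := (L k).1; have E' k := (L k).2.
have [y1E y2E lE] := frame_change_alg e1 e2 e3
  (etrans e4 (sum_sqr_congr (E 0) (E 1) (E 2)))
  (etrans e5 (sum_sqr_congr (E' 0) (E' 1) (E' 2)))
  (etrans e6 (dot_congr (E 0) (E 1) (E 2) (E' 0) (E' 1) (E' 2))) l0 d.
rewrite y1E y2E in J L.
exists x1, x2; split => //.
by apply/eqP => x0; move: l0'; rewrite lE x0 mul0r ltxx.
Qed.

Lemma lien2_alg (a b x y x1 x2 l : R) : l != 0 -> x1 ^+ 2 + x2 ^+ 2 != 0 ->
  ((x1 * a + x2 * x) * (- x2 * b + x1 * y) - (x1 * b + x2 * y) * (- x2 * a + x1 * x)) /
    ((x1 ^+ 2 + x2 ^+ 2) * l) = (a * y - b * x) / l.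
Proof. by move=> l0 x0; field; rewrite x0 l0. Qed.

(** A Cauchy-Riemann Jacobian multiplies the cross product and the conformal factor by the same
    number. *)
Lemma lien2_indep c a p : conformal_parameter f c -> conformal_parameter f a ->
  chart_dom c p -> chart_dom a p ->
  lien f c 2 (chart_map c p) = lien f a 2 (chart_map a p).
Proof.
move=> cc ca cp ap; have [x1 [x2 [x0 lE L _]]] := conformal_jac cc ca cp ap.
have l0 := lt0r_neq0 (conformal_factor_gt0 ca (chart_im_map ap)).
by rewrite /lien lE (L 0).1 (L 0).2 (L 1).1 (L 1).2; exact: lien2_alg.
Qed.

(* The derivative of [g] along the tangential part of the Killing field [d/dz]. *)
Definition grad3 c g q : R :=
  (liex f c 2 q * 'D_ex (rep g c) q + liey f c 2 q * 'D_ey (rep g c) q) / conformal_factor f c q.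

Lemma grad3_alg (a x A B x1 x2 l : R) : l != 0 -> x1 ^+ 2 + x2 ^+ 2 != 0 ->
  ((x1 * a + x2 * x) * (x1 * A + x2 * B) + (- x2 * a + x1 * x) * (- x2 * A + x1 * B)) /
    ((x1 ^+ 2 + x2 ^+ 2) * l) = (a * A + x * B) / l.
Proof. by move=> l0 x0; field; rewrite x0 l0. Qed.

(** The pair (X_3, Y_3) and the partial derivatives of [g] undergo the same similarity, so their
    inner product scales like the conformal factor. *)
Lemma grad3_indep c a p (g : M -> R) : conformal_parameter f c -> conformal_parameter f a ->
  chart_dom c p -> chart_dom a p -> C1at (rep g a) (chart_map a p) ->
  grad3 c g (chart_map c p) = grad3 a g (chart_map a p).
Proof.
move=> cc ca cp ap cg; have [x1 [x2 [x0 lE L J]]] := conformal_jac cc ca cp ap.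
have [_ Ex Ey] := J g cg.
have l0 := lt0r_neq0 (conformal_factor_gt0 ca (chart_im_map ap)).
rewrite /grad3 lE (L 2).1 (L 2).2 Ex Ey; exact: grad3_alg.
Qed.

Lemma cross3_lie (p v w : 'rV[R]_3) : cross3 v w =
  left_to_lie p v 0 0 * left_to_lie p w 0 1 - left_to_lie p v 0 1 * left_to_lie p w 0 0.
Proof. by rewrite !left_to_lieE. Qed.

(** The sectional curvature is computed in an atlas frame, which may fail to be conformal, and the
    normal in a conformal one. The change of frame multiplies the cross product by its determinant
    [D] and the Gram determinant by D^2, so the quotient is unchanged. *)
Lemma tangent_curvature_alg (a b d x y z l x1 x2 y1 y2 : R) :
  l = (x1 * a + x2 * x) ^+ 2 + (x1 * b + x2 * y) ^+ 2 + (x1 * d + x2 * z) ^+ 2 ->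
  l = (y1 * a + y2 * x) ^+ 2 + (y1 * b + y2 * y) ^+ 2 + (y1 * d + y2 * z) ^+ 2 ->
  0 = (x1 * a + x2 * x) * (y1 * a + y2 * x) + (x1 * b + x2 * y) * (y1 * b + y2 * y)
    + (x1 * d + x2 * z) * (y1 * d + y2 * z) ->
  l != 0 ->
  let A := (a * a + b * b + d * d) * (x * x + y * y + z * z) - (a * x + b * y + d * z) ^+ 2 in
  A != 0 /\ (a * y - b * x) ^+ 2 / A =
    (((x1 * a + x2 * x) * (y1 * b + y2 * y) - (x1 * b + x2 * y) * (y1 * a + y2 * x)) / l) ^+ 2.
Proof.
move=> e4 e5 e6 l0 A; set D := x1 * y2 - x2 * y1.
have E : l ^+ 2 = D ^+ 2 * A.
  transitivity (((x1 * a + x2 * x) ^+ 2 + (x1 * b + x2 * y) ^+ 2 + (x1 * d + x2 * z) ^+ 2) *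
    ((y1 * a + y2 * x) ^+ 2 + (y1 * b + y2 * y) ^+ 2 + (y1 * d + y2 * z) ^+ 2) -
    ((x1 * a + x2 * x) * (y1 * a + y2 * x) + (x1 * b + x2 * y) * (y1 * b + y2 * y)
    + (x1 * d + x2 * z) * (y1 * d + y2 * z)) ^+ 2); last by rewrite /D /A; ring.
  by rewrite -e4 -e5 -e6 expr0n subr0 expr2.
have l2 : l ^+ 2 != 0 by rewrite expf_neq0.
have D0 : D != 0 by apply: contraNneq l2 => D0; rewrite E D0 expr0n mul0r.
have A0 : A != 0 by apply: contraNneq l2 => A0; rewrite E A0 mulr0.
split => //; rewrite expr_div_n E.
rewrite (_ : _ - (x1 * b + x2 * y) * _ = D * (a * y - b * x)); last by rewrite /D; ring.
by field; rewrite D0 A0.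
Qed.

Lemma tangent_curvature (Khat : M -> R) c p : is_tangent_sectional_curvature f Khat ->
  conformal_parameter f c -> chart_dom c p ->
  Khat p = 4^-1 - lien f c 2 (chart_map c p) ^+ 2.
Proof.
move=> hK cc cp; have [a aa ap] := surface_cover p; have oa := atlas_oriented_chart aa.
have := hK a aa _ (chart_im_map ap); rewrite (chart_mapK ap) => ->.
have [x1 [x2 [y1 [y2 [d J]]]]] := oriented_chart_jac cc.1 oa cp ap.
have L := jac_liex J oa ap cp.
have [e4 e5 e6] := conformal_frame cc (chart_im_map cp).
have l0 := lt0r_neq0 (conformal_factor_gt0 cc (chart_im_map cp)).
have E k := (L k).1; have E' k := (L k).2.
have [A0 AE] := tangent_curvature_alg
  (etrans e4 (sum_sqr_congr (E 0) (E 1) (E 2)))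
  (etrans e5 (sum_sqr_congr (E' 0) (E' 1) (E' 2)))
  (etrans e6 (dot_congr (E 0) (E 1) (E 2) (E' 0) (E' 1) (E' 2))) l0.
have cr : cross3 (local_derive ex f a (chart_map a p)) (local_derive ey f a (chart_map a p)) =
  liex f a 0 (chart_map a p) * liey f a 1 (chart_map a p) -
  liex f a 1 (chart_map a p) * liey f a 0 (chart_map a p).
  exact: cross3_lie.
have S := @sectional_nil_g _ (local_map f a (chart_map a p))
  (local_derive ex f a (chart_map a p)) (local_derive ey f a (chart_map a p)).
rewrite cr !nil_form_lie in S; apply: (etrans (S A0)); congr (_ - _).
rewrite [LHS]AE /lien (E 0) (E 1) (E' 0) (E' 1).
by [].
Qed.

End Pointwise.

(** * The square of the potential in terms of H and n_3 *)

Section Potential.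
Context {R : realType} {M : closed_oriented_surface R}.
Variables (f : M -> 'rV[R]_3) (hf : immersion f).
Implicit Types (c a : chart R M) (p : M) (q : plane R) (k : 'I_3).

Lemma potential_alg (h N1 N2 : R) :
  let U := (h / 2)%:C * (N1%:C + N2%:C) + 'i / 4 * (N2%:C - N1%:C) in
  complex.Re U = h / 2 * (N1 + N2) /\ complex.Im U = (N2 - N1) / 4.
Proof. by split; rewrite !reim; field. Qed.

Lemma potential_ReIm (h : R) (s1 s2 : R[i]) :
  let N1 := complex.Re s1 ^+ 2 + complex.Im s1 ^+ 2 in
  let N2 := complex.Re s2 ^+ 2 + complex.Im s2 ^+ 2 in
  complex.Re (potential h s1 s2) = h / 2 * (N1 + N2) /\
  complex.Im (potential h s1 s2) = (N2 - N1) / 4.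
Proof.
by rewrite /potential !normC_sq; exact: potential_alg.
Qed.

Lemma spinor_factor_alg (a1 b1 a2 b2 : R) :
  let N1 := a1 ^+ 2 + b1 ^+ 2 in let N2 := a2 ^+ 2 + b2 ^+ 2 in
  let l := (2 * (a2 * b2 - a1 * b1)) ^+ 2 + (a2 * a2 - b2 * b2 - a1 * a1 + b1 * b1) ^+ 2 +
    (2 * (a1 * a2 + b1 * b2)) ^+ 2 in
  l != 0 -> l = (N1 + N2) ^+ 2 /\
  (2 * (a2 * b2 - a1 * b1) * (2 * (a2 * b2 + a1 * b1)) -
   (a2 * a2 - b2 * b2 - a1 * a1 + b1 * b1) * - (a2 * a2 - b2 * b2 + a1 * a1 - b1 * b1)) / l =
  (N2 - N1) / (N1 + N2).
Proof.
move=> N1 N2 l; have -> : l = (N1 + N2) ^+ 2 by rewrite /l /N1 /N2; ring.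
rewrite sqrf_eq0 => N0; split => //.
rewrite (_ : _ - _ = (N2 - N1) * (N1 + N2)); last by rewrite /N1 /N2; ring.
by field.
Qed.

Lemma spinor_factor c psi1 psi2 q : generating_spinor f c psi1 psi2 ->
  conformal_parameter f c -> chart_im c q ->
  let N1 := complex.Re (psi1 q) ^+ 2 + complex.Im (psi1 q) ^+ 2 in
  let N2 := complex.Re (psi2 q) ^+ 2 + complex.Im (psi2 q) ^+ 2 in
  conformal_factor f c q = (N1 + N2) ^+ 2 /\ lien f c 2 q = (N2 - N1) / (N1 + N2).
Proof.
move=> gs cc cq; have [e1 _ _] := conformal_frame cc cq.
have l0 := lt0r_neq0 (conformal_factor_gt0 hf cc cq).
have [[x0 x1 x2] [y0 y1 y2]] := spinor_frame gs cq.
rewrite -[lien f c 2 q]/((liex f c 0 q * liey f c 1 q - liex f c 1 q * liey f c 0 q) /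
  conformal_factor f c q).
move: l0; rewrite e1 x0 x1 x2 y0 y1.
exact: spinor_factor_alg.
Qed.

Lemma potential_sq_alg (h N1 N2 : R) : N1 + N2 != 0 ->
  h / 2 * (N1 + N2) * (h / 2 * (N1 + N2)) - (N2 - N1) / 4 * ((N2 - N1) / 4) =
    (h ^+ 2 - ((N2 - N1) / (N1 + N2)) ^+ 2 / 4) / 4 * (N1 + N2) ^+ 2 /\
  h / 2 * (N1 + N2) * ((N2 - N1) / 4) + (N2 - N1) / 4 * (h / 2 * (N1 + N2)) =
    h * ((N2 - N1) / (N1 + N2)) / 4 * (N1 + N2) ^+ 2.
Proof. by move=> N0; split; field. Qed.

Lemma potential_sq c psi1 psi2 q (h : R) : generating_spinor f c psi1 psi2 ->
  conformal_parameter f c -> chart_im c q ->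
  complex.Re (potential h (psi1 q) (psi2 q) * potential h (psi1 q) (psi2 q)) =
    (h ^+ 2 - lien f c 2 q ^+ 2 / 4) / 4 * conformal_factor f c q /\
  complex.Im (potential h (psi1 q) (psi2 q) * potential h (psi1 q) (psi2 q)) =
    h * lien f c 2 q / 4 * conformal_factor f c q.
Proof.
move=> gs cc cq; have [lE nE] := spinor_factor gs cc cq.
have l0 := lt0r_neq0 (conformal_factor_gt0 hf cc cq).
have [rE iE] := potential_ReIm h (psi1 q) (psi2 q).
rewrite cReM cImM rE iE nE; move: l0; rewrite lE sqrf_eq0; exact: potential_sq_alg.
Qed.

End Potential.

(** * Continuity of the mean curvature *)

Section Continuity.
Context {R : realType} {M : closed_oriented_surface R}.
Variables (f : M -> 'rV[R]_3) (hf : immersion f).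
Variables (c : chart R M) (psi1 psi2 : plane R -> R[i]).
Hypotheses (conf : conformal_parameter f c) (gs : generating_spinor f c psi1 psi2).

Lemma conformal_factor_C1at q : chart_im c q -> C1at (conformal_factor f c) q.
Proof.
move=> cq; have X k := (spinor_C1at k gs cq).1.
apply: (C1at_near_eq _ (C1atD (C1atD (C1atM (X 0) (X 0)) (C1atM (X 1) (X 1))) (C1atM (X 2) (X 2)))).
apply: filterS (near_chart_im cq) => p cp.
by have [-> _ _] := conformal_frame conf cp; rewrite !expr2.
Qed.

Lemma lien_C1at k q : chart_im c q -> C1at (lien f c k) q.
Proof.
move=> cq; have X j := (spinor_C1at j gs cq).1; have Y j := (spinor_C1at j gs cq).2.
have L := C1atV (lt0r_neq0 (conformal_factor_gt0 hf conf cq)) (conformal_factor_C1at cq).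
move: k; apply: ord3P.
- exact: (C1atM (C1atB (C1atM (X 1) (Y 2)) (C1atM (X 2) (Y 1))) L).
- exact: (C1atM (C1atB (C1atM (X 2) (Y 0)) (C1atM (X 0) (Y 2))) L).
- exact: (C1atM (C1atB (C1atM (X 0) (Y 1)) (C1atM (X 1) (Y 0))) L).
Qed.

Lemma quad_continuous (a b d : R) : continuous (quad a b d).
Proof.
move=> t.
have C (u : R) : {for t, continuous (fun _ : R => u)} by exact: cvg_cst.
have I : {for t, continuous (fun x : R => x)} by exact: cvg_id.
have S : {for t, continuous (fun x : R => x ^+ 2)} by exact: exprn_continuous.
exact: (continuous_forD (continuous_forD (C a) (continuous_forM (C b) I))
  (continuous_forM (C d) S)).
Qed.

Lemma nil_gamma_continuous (k i j : 'I_3) : continuous (nil_gamma k i j : R -> R).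
Proof. by rewrite /nil_gamma; do ![case: ifP => _]; exact: quad_continuous. Qed.

Lemma continuous_for_sum3 (G : 'I_3 -> plane R -> R) q :
  (forall i, {for q, continuous (G i)}) -> {for q, continuous (fun p => \sum_i G i p)}.
Proof.
move=> cG; rewrite (_ : (fun p => _) = fun p => G 0 p + G 1 p + G 2 p).
  exact: (continuous_forD (continuous_forD (cG 0) (cG 1)) (cG 2)).
by apply/funext => p; rewrite sum_ord3.
Qed.

Lemma nabla_re_continuous k q : chart_im c q -> {for q, continuous (nabla_re f c k)}.
Proof.
move=> cq; have [_ cx _] := derive_ex_coordf_C1at hf conf gs cq k.
have [_ _ cy] := derive_ey_coordf_C1at hf conf gs cq k.
have DX j : {for q, continuous ('D_ex (rep (coordf f j) c))} :=
  C1at_continuous (derive_ex_coordf_C1at hf conf gs cq j).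
have DY j : {for q, continuous ('D_ey (rep (coordf f j) c))} :=
  C1at_continuous (derive_ey_coordf_C1at hf conf gs cq j).
have F0 := C1at_continuous (coordf_C1at 0 hf conf.1 cq).
have G i l : {for q, continuous (fun p => christoffel nil_g k i l (local_map f c p))}.
  have -> : (fun p => christoffel nil_g k i l (local_map f c p)) =
      nil_gamma k i l \o rep (coordf f 0) c.
    by apply/funext => p; rewrite christoffel_nil_g.
  exact: (continuous_comp F0 (@nil_gamma_continuous k i l _)).
have S := continuous_for_sum3 (fun i => continuous_for_sum3 (fun l =>
  continuous_forM (G i l)
    (continuous_forD (continuous_forM (DX i) (DX l)) (continuous_forM (DY i) (DY l))))).
exact: (continuous_forD (continuous_forD cx cy) S).
Qed.

Lemma liew_continuous k q : chart_im c q -> {for q, continuous (liew f c k)}.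
Proof.
move=> cq; have N j : {for q, continuous (nabla_re f c j)} by exact: nabla_re_continuous.
have F0 := C1at_continuous (coordf_C1at 0 hf conf.1 cq).
have c4 : {for q, continuous (fun _ : plane R => 4^-1 : R)} by exact: cvg_cst.
case: (eqVneq k 2) => [->|k2].
  have N1 : {for q, continuous (fun p => - (rep (coordf f 0) c p * nabla_re f c 1 p))}.
    exact: cvgN (continuous_forM F0 (N 1)).
  exact: (continuous_forM (continuous_forD (N 2) N1) c4).
rewrite (_ : liew f c k = fun p => nabla_re f c k p * 4^-1).
  exact: (continuous_forM (N k) c4).
by apply/funext => p; rewrite /liew (negbTE k2).
Qed.

Lemma mean_curvature_continuous (H : M -> R) q : is_mean_curvature f H -> chart_im c q ->
  {for q, continuous (rep H c)}.
Proof.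
move=> hH cq; have n k : {for q, continuous (lien f c k)} := C1at_continuous (lien_C1at k cq).
have w k : {for q, continuous (liew f c k)} by exact: liew_continuous.
have L := C1at_continuous
  (C1atV (lt0r_neq0 (conformal_factor_gt0 hf conf cq)) (conformal_factor_C1at cq)).
apply: (@near_eq_continuous_for _ _ (fun p => 2 * (conformal_factor f c p)^-1 *
  (lien f c 0 p * liew f c 0 p + lien f c 1 p * liew f c 1 p + lien f c 2 p * liew f c 2 p))).
  apply: filterS (near_chart_im cq) => p cp.
  by rewrite /rep (mean_curvature_formula hf hH conf gs cp).
have c2 : {for q, continuous (fun _ : plane R => 2 : R)} by exact: cvg_cst.
exact: (continuous_forM (continuous_forM c2 L) (continuous_forD (continuous_forD
  (continuous_forM (n 0) (w 0)) (continuous_forM (n 1) (w 1))) (continuous_forM (n 2) (w 2)))).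
Qed.

End Continuity.

(** * Integration over the surface *)

Section ChartIntegrals.
Context {R : realType} {M : closed_oriented_surface R}.
Variables (f : M -> 'rV[R]_3) (hf : immersion f).
Variables (mu : {measure set (borel M) -> \bar R}) (hmu : is_area_measure f mu).
Local Notation mplane := (measurableTypeR R * measurableTypeR R)%type.

Lemma borel_open (U : set M) : open U -> measurable (U : set (borel M)).
Proof. by move=> oU; exact: sub_sigma_algebra. Qed.

Lemma borel_closed (U : set M) : closed U -> measurable (U : set (borel M)).
Proof. by move=> /closed_openC/borel_open/measurableC; rewrite setCK. Qed.

Lemma continuous_borel (h : M -> R) : continuous h ->
  measurable_fun [set: borel M] (h : borel M -> measurableTypeR R).
Proof.
move=> ch; apply: measurable_fun_RGenOpens => U oU; rewrite setTI.
by apply: borel_open; move/continuousP : ch; exact.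
Qed.

Lemma chart_inv_measurable (c : chart R M) :
  measurable_fun (chart_im c : set mplane) (chart_inv c : mplane -> borel M).
Proof.
apply: measurable_fun_borel => U oU; apply: plane_preimage_measurable => //.
- by apply: plane_open_measurable; exact: chart_im_open.
- by move=> q cq; exact: chart_inv_cont.
Qed.

(** Trades an image for a preimage under [chart_inv], for which measurability and intersections are
    immediate. *)
Lemma chart_image_preimage (c : chart R M) (A : set M) : A `<=` chart_dom c ->
  chart_map c @` A = chart_im c `&` chart_inv c @^-1` A.
Proof.
move=> Ac; apply/seteqP; split => [_ [p Ap <-]|q [cq Aq]].
  by split; [exact: chart_im_map (Ac _ Ap)|rewrite /= (chart_mapK (Ac _ Ap))].
by exists (chart_inv c q) => //; exact: (chart_im_inv cq).2.
Qed.

Lemma chart_image_measurable (c : chart R M) (A : set (borel M)) :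
  measurable A -> A `<=` chart_dom c -> measurable (chart_map c @` A : set mplane).
Proof.
move=> mA Ac; rewrite (chart_image_preimage Ac).
apply: chart_inv_measurable => //.
by apply: plane_open_measurable; exact: chart_im_open.
Qed.

Variables (c : chart R M) (psi1 psi2 : plane R -> R[i]).
Hypotheses (conf : conformal_parameter f c) (gs : generating_spinor f c psi1 psi2).

(** On the Borel subsets of [A], [is_area_measure] supplies the hypothesis of [integral_density],
    with density e^(2 alpha). *)
Lemma chart_integral (A : set (borel M)) (h : M -> R) :
  measurable A -> A `<=` chart_dom c -> mu.-integrable A (EFin \o (h : borel M -> R)) ->
  lebesgue2.-integrable (chart_map c @` A : set mplane)
    (fun q => (h (chart_inv c q) * conformal_factor f c q)%:E) /\
  (\int[mu]_(p in A) (h p)%:E =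
   \int[lebesgue2]_(q in (chart_map c @` A : set mplane))
     (h (chart_inv c q) * conformal_factor f c q)%:E)%E.
Proof.
move=> mA Ac ih.
have mB := chart_image_measurable mA Ac.
have Bim : chart_map c @` A `<=` chart_im c.
  by move=> _ [p Ap <-]; exact: chart_im_map (Ac _ Ap).
apply: (@integral_density _ _ _ _ R mu lebesgue2 A (chart_map c @` A) (chart_inv c)
  (conformal_factor f c)) => //.
- apply: measurable_funS (chart_inv_measurable (c := c)) => //.
  by apply: plane_open_measurable; exact: chart_im_open.
- apply: plane_measurable_fun => // q /Bim cq.
  exact: C1at_continuous (conformal_factor_C1at conf gs cq).
- by move=> q /Bim cq; exact/ltW/(conformal_factor_gt0 hf conf cq).
- by move=> _ [p Ap <-]; rewrite (chart_mapK (Ac _ Ap)).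
- move=> E mE EA; rewrite (hmu conf mE (subset_trans EA Ac)).
  congr (integral _ _ _).
  rewrite (chart_image_preimage Ac) (chart_image_preimage (subset_trans EA Ac)) -setIA.
  congr (_ `&` _); apply/seteqP; split => q /=.
    by move=> Eq; split => //; exact: EA.
  by case.
Qed.

Lemma chart_square_closed q r : square q r `<=` chart_im c ->
  closed (chart_inv c @` square q r).
Proof.
move=> sc; apply: compact_closed; first exact: surface_hausdorff.
apply: continuous_compact; last exact: square_compact.
by apply/continuous_in_subspaceT => p; rewrite inE => /sc; exact: chart_inv_cont.
Qed.

Lemma chart_square_sub q r : square q r `<=` chart_im c ->
  chart_inv c @` square q r `<=` chart_dom c.
Proof. by move=> sc _ [p /sc cp <-]; exact: (chart_im_inv cp).1. Qed.

Lemma chart_map_square q r : square q r `<=` chart_im c ->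
  chart_map c @` (chart_inv c @` square q r) = square q r.
Proof.
move=> sc; apply/seteqP; split => [_ [_ [p sp <-] <-]|p sp].
  by rewrite (chart_im_inv (sc _ sp)).2.
by exists (chart_inv c p); [exists p|exact: (chart_im_inv (sc _ sp)).2].
Qed.

Lemma chart_square_finite q r : square q r `<=` chart_im c ->
  (mu (chart_inv c @` square q r : set (borel M)) < +oo)%E.
Proof.
move=> sc.
rewrite (hmu conf (borel_closed (chart_square_closed sc)) (chart_square_sub sc)).
rewrite (chart_map_square sc).
have /integrable_lty : lebesgue2.-integrable (square q r : set mplane)
    (fun p => (conformal_factor f c p)%:E).
  apply: square_integrable => p /sc cp.
  exact: C1at_continuous (conformal_factor_C1at conf gs cp).
by apply; exact: square_measurable.
Qed.

End ChartIntegrals.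

(** * Bump functions and the divergence theorem *)

Section Bump.
Context {R : realType}.

(** For positive [r] it is positive exactly on the open square. The product form makes the support a
    square, to which [integral_square_ex] and [integral_square_ey] apply. *)
Definition bump2 (q : plane R) (r : R) (z : plane R) : R :=
  sqpos (r ^+ 2 - (z.1 - q.1) ^+ 2) * sqpos (r ^+ 2 - (z.2 - q.2) ^+ 2).

Lemma sqpos_ge0 (t : R) : 0 <= sqpos t. Proof. exact: sqr_ge0. Qed.

Lemma sqpos_gt0 (t : R) : 0 < t -> 0 < sqpos t.
Proof. by move=> t0; rewrite /sqpos max_r ?exprn_gt0// ltW. Qed.

Lemma sqpos_eq0 (t : R) : t <= 0 -> sqpos t = 0.
Proof. by move=> t0; rewrite /sqpos max_l// expr0n. Qed.

Lemma bump2_C1at q r z : C1at (bump2 q r) z.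
Proof.
have S (h : plane R -> R) (a : R) : C1at h z -> C1at (fun p => sqpos (r ^+ 2 - (h p - a) ^+ 2)) z.
  move=> ch; apply: C1at_sqpos; have d := C1atB ch (C1at_cst a z).
  exact: (C1atB (C1at_cst (r ^+ 2) z) (C1atM d d)).
exact: (C1atM (S _ q.1 (C1at_fst z)) (S _ q.2 (C1at_snd z))).
Qed.

Lemma bump2_ge0 q r z : 0 <= bump2 q r z.
Proof. by rewrite mulr_ge0 ?sqpos_ge0. Qed.

Lemma sqr_lt_dist (r a b : R) : 0 < r -> (0 < r ^+ 2 - (a - b) ^+ 2) = (b - r < a < b + r).
Proof.
move=> r0; rewrite subr_gt0 -ltr_distlC -(distrC a b) -real_normK ?num_real//.
by rewrite ltr_pXn2r// nnegrE ltW.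
Qed.

Lemma bump2_gt0 q r z : 0 < r -> q.1 - r < z.1 < q.1 + r -> q.2 - r < z.2 < q.2 + r ->
  0 < bump2 q r z.
Proof. by move=> r0 z1 z2; rewrite mulr_gt0// sqpos_gt0// sqr_lt_dist. Qed.

Lemma bump2_eq0 q r z : 0 < r -> ~~ ((q.1 - r < z.1 < q.1 + r) && (q.2 - r < z.2 < q.2 + r)) ->
  bump2 q r z = 0.
Proof.
by move=> r0; rewrite negb_and -!(sqr_lt_dist _ _ r0) -!leNgt /bump2 => /orP[] /sqpos_eq0 ->;
  rewrite ?mul0r ?mulr0.
Qed.

Lemma bump2_notin q r z : 0 < r -> ~ square q r z -> bump2 q r z = 0.
Proof.
move=> r0 nz; apply: bump2_eq0 => //; apply/negP => /andP[/andP[a b] /andP[e d]].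
by apply: nz; split; rewrite /= in_itv/= !ltW.
Qed.

End Bump.

Section SurfaceBump.
Context {R : realType} {M : closed_oriented_surface R}.
Variables (f : M -> 'rV[R]_3) (hf : immersion f).

Definition C1M (g : M -> R) : Prop := forall c, conformal_parameter f c ->
  forall p, chart_dom c p -> C1at (rep g c) (chart_map c p).

(** One parameter around each point suffices, since the Jacobian relation carries [C1at] to any
    other conformal parameter. *)
Lemma C1M_local (g : M -> R) :
  (forall p, exists c,
    [/\ conformal_parameter f c, chart_dom c p & C1at (rep g c) (chart_map c p)]) ->
  C1M g.
Proof.
move=> H c cc p cp; have [a [ca ap cg]] := H p.
by have [x1 [x2 [_ _ _ /(_ g cg)[]]]] := conformal_jac hf cc ca cp ap.
Qed.

Lemma C1M_cst (x : R) : C1M (fun=> x).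
Proof. by move=> c _ p _; exact: C1at_cst. Qed.

Lemma C1MD g h : C1M g -> C1M h -> C1M (fun p => g p + h p).
Proof. by move=> cg ch c cc p cp; exact: (C1atD (cg c cc p cp) (ch c cc p cp)). Qed.

Lemma C1MM g h : C1M g -> C1M h -> C1M (fun p => g p * h p).
Proof. by move=> cg ch c cc p cp; exact: (C1atM (cg c cc p cp) (ch c cc p cp)). Qed.

Lemma C1MV g : (forall p, g p != 0) -> C1M g -> C1M (fun p => (g p)^-1).
Proof. by move=> g0 cg c cc p cp; apply: (C1atV _ (cg c cc p cp)); rewrite /rep; exact: g0. Qed.

Variables (c : chart R M) (q : plane R) (r : R).
Hypotheses (conf : conformal_parameter f c) (r0 : 0 < r) (sc : square q r `<=` chart_im c).

Definition surface_bump (p : M) : R :=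
  if `[< chart_dom c p >] then bump2 q r (chart_map c p) else 0.

Lemma surface_bump_ge0 p : 0 <= surface_bump p.
Proof. by rewrite /surface_bump; case: ifP => // _; exact: bump2_ge0. Qed.

Lemma rep_surface_bump z : chart_im c z -> rep surface_bump c z = bump2 q r z.
Proof. by move=> cz; have [d e] := chart_im_inv cz; rewrite /rep /surface_bump asboolT ?e. Qed.

Lemma surface_bump_notin p : ~ (chart_inv c @` square q r) p -> surface_bump p = 0.
Proof.
move=> np; rewrite /surface_bump; case: ifPn => // /asboolP cp; apply: bump2_notin => // sp.
by apply: np; exists (chart_map c p) => //; rewrite chart_mapK.
Qed.

Lemma near_surface_bump0 p : ~ (chart_inv c @` square q r) p ->
  \forall p' \near p, ~ (chart_inv c @` square q r) p'.
Proof.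
move=> np; apply: (@open_nbhs_nbhs _ p (~` (chart_inv c @` square q r))); split => //.
by apply: closed_openC; exact: chart_square_closed.
Qed.

Lemma near_rep0 (a : chart R M) (g : M -> R) p : chart_dom a p ->
  ~ (chart_inv c @` square q r) p -> (forall p', ~ (chart_inv c @` square q r) p' -> g p' = 0) ->
  \forall z \near chart_map a p, 0 = rep g a z.
Proof.
move=> ap np g0; apply: filterS (near_chart_inv ap (near_surface_bump0 np)) => z nz.
by rewrite /rep g0.
Qed.

Lemma surface_bump_C1M :
  (forall p, exists2 a, conformal_parameter f a & chart_dom a p) -> C1M surface_bump.
Proof.
move=> cov; apply: C1M_local => p; have [cp|ncp] := pselect (chart_dom c p).
  exists c; split => //; apply: C1at_near_eq (bump2_C1at q r _).
  by apply: filterS (near_chart_im (chart_im_map cp)) => z /rep_surface_bump.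
(* Outside the chart: the image of the square is compact in a Hausdorff space, hence closed, and
   misses [p], so the bump is 0 near [p]. *)
have [a ca ap] := cov p; exists a; split => //.
have np : ~ (chart_inv c @` square q r) p by move=> /(chart_square_sub sc).
exact: C1at_near_eq (near_rep0 ap np surface_bump_notin) (C1at_cst 0 _).
Qed.

End SurfaceBump.

(** * The divergence theorem for the tangential part of the Killing field *)

Section Stokes.
Context {R : realType} {M : closed_oriented_surface R}.
Variables (f : M -> 'rV[R]_3) (hf : immersion f) (H : M -> R) (hH : is_mean_curvature f H).
Variables (mu : {measure set (borel M) -> \bar R}) (hmu : is_area_measure f mu).
Variable P : spinor_partition f.
Local Notation mplane := (measurableTypeR R * measurableTypeR R)%type.
Local Notation ch i := (sp_chart (s := P) i).

Lemma sp_index p : {i : 'I_(sp_size P) | sp_piece i p}.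
Proof.
apply: cid; have : [set: M] p by [].
by rewrite -(sp_cover P) => -[i _ ip]; exists i.
Qed.

Definition chart_at p : chart R M := ch (sval (sp_index p)).

Lemma chart_at_dom p : chart_dom (chart_at p) p.
Proof. by apply: sp_sub; exact: (svalP (sp_index p)). Qed.

Lemma chart_at_conformal p : conformal_parameter f (chart_at p).
Proof. exact: sp_conformal. Qed.

(** The chart chosen at [p] may jump as [p] moves. By [normal3E] the value does not depend on the
    choice, which is what makes continuity provable. *)
Definition normal3 p : R := lien f (chart_at p) 2 (chart_map (chart_at p) p).

Definition grad3_at (g : M -> R) p : R := grad3 f (chart_at p) g (chart_map (chart_at p) p).

Lemma normal3E c p : conformal_parameter f c -> chart_dom c p ->
  normal3 p = lien f c 2 (chart_map c p).
Proof. by move=> cc cp; exact: (lien2_indep hf (chart_at_conformal p) cc (chart_at_dom p) cp). Qed.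

Lemma grad3_atE g c p : C1M f g -> conformal_parameter f c -> chart_dom c p ->
  grad3_at g p = grad3 f c g (chart_map c p).
Proof.
move=> cg cc cp.
exact: (grad3_indep hf (chart_at_conformal p) cc (chart_at_dom p) cp (cg c cc p cp)).
Qed.

Lemma surface_continuous (h : M -> R) :
  (forall i p, chart_dom (ch i) p -> {for chart_map (ch i) p, continuous (rep h (ch i))}) ->
  continuous h.
Proof.
move=> ch_ p; have cp := chart_at_dom p.
have E : \forall p' \near p, (rep h (chart_at p) \o chart_map (chart_at p)) p' = h p'.
  by apply: filterS (near_chart_dom cp) => p' cp'; rewrite /= /rep chart_mapK.
apply: (near_eq_continuous_for E).
exact: (continuous_comp (chart_map_cont cp) (ch_ _ _ cp)).
Qed.

(* [Theta g] is the density of the divergence of [g] times the tangential part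
   of the Killing field [d/dz]. *)
Definition Theta (g : M -> R) p : R := 2 * g p * H p * normal3 p + grad3_at g p.

Lemma near_normal3 c q : conformal_parameter f c -> chart_im c q ->
  \forall z \near q, lien f c 2 z = rep normal3 c z.
Proof.
move=> cc cq; apply: filterS (near_chart_im cq) => z cz; have [cp e] := chart_im_inv cz.
by rewrite /rep (normal3E cc cp) e.
Qed.

Lemma normal3_continuous : continuous normal3.
Proof.
apply: surface_continuous => i p cp; have cq := chart_im_map cp.
apply: near_eq_continuous_for (near_normal3 (sp_conformal i) cq) _.
exact: C1at_continuous (lien_C1at hf (sp_conformal i) (sp_spinor i) 2 cq).
Qed.

Lemma H_continuous : continuous H.
Proof.
apply: surface_continuous => i p cp; have cq := chart_im_map cp.
exact: (mean_curvature_continuous hf (sp_conformal i) (sp_spinor i) hH cq).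
Qed.

Lemma C1M_continuous g : C1M f g -> continuous g.
Proof.
move=> cg; apply: surface_continuous => i p cp.
exact: C1at_continuous (cg _ (sp_conformal i) _ cp).
Qed.

Lemma grad3_at_continuous g : C1M f g -> continuous (grad3_at g).
Proof.
move=> cg; apply: surface_continuous => i p cp; have cq := chart_im_map cp.
have cc := sp_conformal i; have gs := sp_spinor i.
apply: (@near_eq_continuous_for _ _ (grad3 f (ch i) g)).
  apply: filterS (near_chart_im cq) => z cz; have [cp' e] := chart_im_inv cz.
  by rewrite /rep (grad3_atE cg cc cp') e.
have [_ gx gy] := cg _ cc _ cp.
have X := C1at_continuous (spinor_C1at 2 gs cq).1.
have Y := C1at_continuous (spinor_C1at 2 gs cq).2.
have L := C1at_continuous
  (C1atV (lt0r_neq0 (conformal_factor_gt0 hf cc cq)) (conformal_factor_C1at cc gs cq)).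
exact: (continuous_forM (continuous_forD (continuous_forM X gx) (continuous_forM Y gy)) L).
Qed.

Lemma Theta_continuous g : C1M f g -> continuous (Theta g).
Proof.
move=> cg p; have c2 : {for p, continuous (fun _ : M => 2 : R)} by exact: cvg_cst.
exact: (continuous_forD (continuous_forM (continuous_forM (continuous_forM c2
  (@C1M_continuous g cg p)) (@H_continuous p)) (@normal3_continuous p)) (@grad3_at_continuous g cg p)).
Qed.

Lemma theta_alg (g h k n x y a b a' b' l : R) :
  2 * (g + h) * k * n + (x * (a + a') + y * (b + b')) / l =
  2 * g * k * n + (x * a + y * b) / l + (2 * h * k * n + (x * a' + y * b') / l).
Proof. by ring. Qed.

Lemma ThetaD g h p : C1M f g -> C1M f h -> Theta (fun p => g p + h p) p = Theta g p + Theta h p.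
Proof.
move=> cg ch_; have dg := C1at_differentiable (cg _ (chart_at_conformal p) _ (chart_at_dom p)).
have dh := C1at_differentiable (ch_ _ (chart_at_conformal p) _ (chart_at_dom p)).
have Ex : 'D_ex _ _ = _ := diff_deriveD ex dg dh; have Ey : 'D_ey _ _ = _ := diff_deriveD ey dg dh.
rewrite /Theta /grad3_at /grad3.
rewrite -[rep (fun p => g p + h p) _]/(fun z => rep g (chart_at p) z + rep h (chart_at p) z) Ex Ey.
exact: theta_alg.
Qed.

Definition radius_at p : R := sval (cid2 (square_in_open (chart_im_open (c := chart_at p))
  (chart_im_map (chart_at_dom p)))).

Lemma radius_at_gt0 p : 0 < radius_at p.
Proof. by rewrite /radius_at; case: cid2. Qed.

Lemma radius_at_sub p : square (chart_map (chart_at p) p) (radius_at p) `<=` chart_im (chart_at p).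
Proof. by rewrite /radius_at; case: cid2. Qed.

Definition bump_at p : M -> R := surface_bump (chart_at p) (chart_map (chart_at p) p) (radius_at p).

Lemma bump_at_self p : 0 < bump_at p p.
Proof.
rewrite /bump_at /surface_bump asboolT; last exact: chart_at_dom.
have r0 := radius_at_gt0 p.
by apply: bump2_gt0 => //; rewrite ltrDl gtrDl oppr_lt0 r0.
Qed.

Lemma bump_at_C1M p : C1M f (bump_at p).
Proof.
apply: (surface_bump_C1M hf (chart_at_conformal p) (radius_at_gt0 p) (@radius_at_sub p)).
by move=> p'; exists (chart_at p'); [exact: chart_at_conformal|exact: chart_at_dom].
Qed.

Definition bump_support p : set M :=
  chart_inv (chart_at p) @` square (chart_map (chart_at p) p) (radius_at p).

Lemma bump_at_cover : exists s : seq M, forall m, exists2 p, p \in s & 0 < bump_at p m.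
Proof.
have := @surface_compact R M; rewrite compact_cover.
move=> /(_ M [set: M] (fun p => [set m | 0 < bump_at p m])).
case.
- move=> p _; have := C1M_continuous (bump_at_C1M p).
  by move=> /continuousP/(_ _ (open_gt (y := 0 : R))).
- by move=> m _; exists m => //; exact: bump_at_self.
- move=> D _ cD; exists (finmap.enum_fset D) => m; have [p Dp pm] := cD m I.
  by exists p.
Qed.

(** [mu] is described only inside conformal parameters. A point where a bump is positive lies in its
    support, so finitely many compact squares, each of finite area, cover M. *)
Lemma area_finite : (mu [set: borel M] < +oo)%E.
Proof.
have [s cs] := bump_at_cover.
have mS p : measurable (bump_support p : set (borel M)).
  apply: borel_closed; exact: chart_square_closed (@radius_at_sub p).
have sub : [set: borel M] `<=` \big[setU/set0]_(p <- s) (bump_support p : set (borel M)).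
  move=> m _; have [p ps bp] := cs m; rewrite -bigcup_seq; exists p => //.
  apply: contrapT => nm; move: bp; rewrite /bump_at (surface_bump_notin (radius_at_gt0 p))// ltxx.
  by [].
have mU : measurable (\big[setU/set0]_(p <- s) (bump_support p : set (borel M))).
  by apply: bigsetU_measurable => p _; exact: mS.
apply: (@le_lt_trans _ _ (mu (\big[setU/set0]_(p <- s) (bump_support p : set (borel M))))).
  by apply: le_measure; rewrite ?inE.
elim: s {cs sub} mU => [|p s IH] mU; first by rewrite big_nil measure0 ltry.
rewrite big_cons.
apply: (@le_lt_trans _ _
  (mu (bump_support p) + mu (\big[setU/set0]_(j <- s) bump_support j))%E).
  apply: measureU2; first exact: mS.
  by apply: bigsetU_measurable => j _; exact: mS.
rewrite lte_add_pinfty//; last by apply: IH; apply: bigsetU_measurable => j _; exact: mS.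
exact: (chart_square_finite hmu (chart_at_conformal p)
  (sp_spinor (sval (sp_index p))) (@radius_at_sub p)).
Qed.

Lemma continuous_area_integrable (h : M -> R) : continuous h ->
  mu.-integrable [set: borel M] (EFin \o (h : borel M -> R)).
Proof.
move=> ch_; apply: measurable_bounded_integrable.
- by [].
- exact: area_finite.
- exact: continuous_borel.
- have : compact (h @` [set: M]).
    apply: continuous_compact; last exact: surface_compact.
    exact: continuous_subspaceT.
  move=> /compact_bounded [N [Nr HN]]; exists N; split => // x Nx p _.
  by apply: (HN x Nx); exists p.
Qed.

(** The integral of the divergence of [g] times the tangential field. It is additive in [g], so its
    vanishing at 1 can be checked one bump at a time. *)
Definition stokes_functional (g : M -> R) : R := \int[mu]_(p in [set: borel M]) Theta g p.

Lemma stokes_functionalD g h : C1M f g -> C1M f h ->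
  stokes_functional (fun p => g p + h p) = stokes_functional g + stokes_functional h.
Proof.
move=> cg ch_; rewrite /stokes_functional -RintegralD//; last 2 first.
- exact: (continuous_area_integrable (Theta_continuous cg)).
- exact: (continuous_area_integrable (Theta_continuous ch_)).
by apply: eq_Rintegral => p _; exact: ThetaD.
Qed.

Lemma divergence_density_alg (dx dy X Y G Gx Gy l h n : R) : l != 0 -> dx + dy = 2 * l * h * n ->
  (2 * G * h * n + (X * Gx + Y * Gy) / l) * l = X * Gx + G * dx + (Y * Gy + G * dy).
Proof.
move=> l0 E; rewrite mulrDl divfK// (_ : _ * _ * _ * _ * l = G * (2 * l * h * n)); last by ring.
by rewrite -E; ring.
Qed.

(** By [divergence_formula] and the product rule, the density times e^(2 alpha) is d_x (X_3 k) + d_y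
    (Y_3 k), and both products vanish on the edges of the square. *)
Lemma Theta_square i (k : M -> R) q r : C1M f k -> 0 < r -> square q r `<=` chart_im (ch i) ->
  (forall z, chart_im (ch i) z -> ~~ ((q.1 - r < z.1 < q.1 + r) && (q.2 - r < z.2 < q.2 + r)) ->
    rep k (ch i) z = 0) ->
  (\int[lebesgue2]_(z in (square q r : set mplane))
    (Theta k (chart_inv (ch i) z) * conformal_factor f (ch i) z)%:E = 0)%E.
Proof.
move=> ck r0 sc k0; set c := ch i in sc k0 *.
have cc : conformal_parameter f c := sp_conformal i; have gs := sp_spinor i.
have cG z : chart_im c z -> C1at (rep k c) z.
  by move=> cz; have [cp e] := chart_im_inv cz; rewrite -e; exact: ck.
have c1 z (cz : chart_im c z) := C1atM (spinor_C1at 2 gs cz).1 (cG z cz).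
have c2 z (cz : chart_im c z) := C1atM (spinor_C1at 2 gs cz).2 (cG z cz).
pose u1 z := liex f c 2 z * rep k c z; pose u2 z := liey f c 2 z * rep k c z.
have i1 : lebesgue2.-integrable (square q r : set mplane) (fun z => ('D_ex u1 z)%:E).
  by apply: square_integrable => z /sc cz; have [_ ? _] := c1 z cz.
have i2 : lebesgue2.-integrable (square q r : set mplane) (fun z => ('D_ey u2 z)%:E).
  by apply: square_integrable => z /sc cz; have [_ _ ?] := c2 z cz.
transitivity (\int[lebesgue2]_(z in (square q r : set mplane)) ('D_ex u1 z + 'D_ey u2 z)%:E)%E.
  apply: eq_integral => z; rewrite inE => /sc cz; congr EFin.
  have [cp e] := chart_im_inv cz.
  have dX := C1at_differentiable (spinor_C1at 2 gs cz).1.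
  have dY := C1at_differentiable (spinor_C1at 2 gs cz).2.
  have dG := C1at_differentiable (cG z cz).
  have E1 : 'D_ex u1 z = _ := diff_deriveM ex dX dG.
  have E2 : 'D_ey u2 z = _ := diff_deriveM ey dY dG.
  have T : Theta k (chart_inv c z) =
      2 * rep k c z * H (chart_inv c z) * lien f c 2 z + grad3 f c k z.
    by rewrite /Theta (normal3E cc cp) (grad3_atE ck cc cp) e.
  apply: etrans (congr1 (fun t => t * conformal_factor f c z) T) _.
  apply: etrans _ (esym (congr2 (fun a b => a + b) E1 E2)).
  exact: (divergence_density_alg _ _ _ _ _
    (lt0r_neq0 (conformal_factor_gt0 hf cc cz)) (divergence_formula hf hH cc gs cz)).
have Z z : square q r z -> ~~ ((q.1 - r < z.1 < q.1 + r) && (q.2 - r < z.2 < q.2 + r)) ->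
    u1 z = 0 /\ u2 z = 0.
  move=> /sc cz nz; have e := k0 z cz nz; split.
    exact: etrans (congr1 (fun t => liex f c 2 z * t) e) (mulr0 _).
  exact: etrans (congr1 (fun t => liey f c 2 z * t) e) (mulr0 _).
have lr (x : R) : x - r <= x - r <= x + r /\ x - r <= x + r <= x + r by lra.
have Z1 := integral_square_ex r0 (fun z sz => c1 z (sc z sz)).
have {}Z1 : (\int[lebesgue2]_(z in (square q r : set mplane)) ('D_ex u1 z)%:E = 0)%E.
  apply: Z1 => y yr; split.
    apply: (Z (q.1 - r, y) _ _).1; last by rewrite /= ltxx.
    by split; rewrite /= in_itv//=; exact: (lr q.1).1.
  apply: (Z (q.1 + r, y) _ _).1; last by rewrite /= ltxx andbF.
  by split; rewrite /= in_itv//=; exact: (lr q.1).2.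
have Z2 := integral_square_ey r0 (fun z sz => c2 z (sc z sz)).
have {}Z2 : (\int[lebesgue2]_(z in (square q r : set mplane)) ('D_ey u2 z)%:E = 0)%E.
  apply: Z2 => x xr; split.
    apply: (Z (x, q.2 - r) _ _).2; last by rewrite /= ltxx andbF.
    by split; rewrite /= in_itv//=; exact: (lr q.2).1.
  apply: (Z (x, q.2 + r) _ _).2; last by rewrite /= ltxx !andbF.
  by split; rewrite /= in_itv//=; exact: (lr q.2).2.
apply: etrans (integralD (square_measurable q r) i1 i2) _.
exact: etrans (congr2 (fun a b => a + b)%E Z1 Z2) (adde0 _).
Qed.

Lemma theta0_alg (g h n X Y l : R) : 2 * (0 * g) * h * n + (X * 0 + Y * 0) / l = 0.
Proof. by ring. Qed.

Lemma Theta_off_support p (g : M -> R) m : C1M f g -> ~ bump_support p m ->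
  Theta (fun m => bump_at p m * g m) m = 0.
Proof.
move=> cg nm; have b0 m' : ~ bump_support p m' -> bump_at p m' = 0.
  by move=> nm'; exact: (surface_bump_notin (radius_at_gt0 p) nm').
(* The gradient term requires the product to vanish on a whole neighbourhood of [m], which the
   closed support provides. *)
have E : \forall z \near chart_map (chart_at m) m,
    0 = rep (fun m => bump_at p m * g m) (chart_at m) z.
  apply: (near_rep0 (@radius_at_sub p) (chart_at_dom m) nm) => m' nm'.
  by rewrite b0// mul0r.
have D0 v : 'D_v (fun _ : plane R => 0 : R) (chart_map (chart_at m) m) = 0 by exact: derive_cst.
rewrite /Theta /grad3_at /grad3 -(near_eq_derive ex E) -(near_eq_derive ey E) !D0 b0//.
exact: theta0_alg.
Qed.

(** The factor [g] is left free, to become the reciprocal of the sum of all bumps in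
    [stokes_one]. *)
Lemma stokes_bump p (g : M -> R) : C1M f g -> stokes_functional (fun m => bump_at p m * g m) = 0.
Proof.
move=> cg; have ck := C1MM (bump_at_C1M p) cg.
have sK := @radius_at_sub p.
have mK := borel_closed (chart_square_closed sK).
have iT := continuous_area_integrable (Theta_continuous ck).
rewrite /stokes_functional.
transitivity (\int[mu]_(m in (bump_support p : set (borel M)))
  Theta (fun m => bump_at p m * g m) m).
  rewrite [RHS]Rintegral_mkcond; apply: eq_Rintegral => m _; rewrite patchE.
  by case: ifPn => // /negP nm; apply: Theta_off_support => // mK'; apply: nm; rewrite inE.
rewrite /Rintegral.
have [_ ->] := chart_integral hf hmu (chart_at_conformal p) (sp_spinor (sval (sp_index p))) mK
  (chart_square_sub sK) (integrableS measurableT mK (@subsetT _ _) iT).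
rewrite (chart_map_square sK) Theta_square//; first exact: radius_at_gt0.
move=> z cz nz; have := rep_surface_bump (chart_map (chart_at p) p) (radius_at p) cz.
rewrite (bump2_eq0 (radius_at_gt0 p) nz) /rep => b0.
by rewrite [bump_at p _]b0 mul0r.
Qed.

End Stokes.

Section Energy.
Context {R : realType} {M : closed_oriented_surface R}.
Variables (f : M -> 'rV[R]_3) (hf : immersion f) (H : M -> R) (hH : is_mean_curvature f H).
Variables (mu : {measure set (borel M) -> \bar R}) (hmu : is_area_measure f mu).
Variable P : spinor_partition f.
Local Notation mplane := (measurableTypeR R * measurableTypeR R)%type.
Local Notation ch i := (sp_chart (s := P) i).
Local Notation stokes := (stokes_functional H mu P).

Lemma stokes_sum (s : seq M) (g : M -> R) : C1M f g ->
  C1M f (fun m => \sum_(p <- s) bump_at P p m * g m) /\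
  stokes (fun m => \sum_(p <- s) bump_at P p m * g m) = 0.
Proof.
move=> cg; elim: s => [|p s [cs IH]].
  have -> : (fun m => \sum_(p <- [::]) bump_at P p m * g m) = fun=> 0.
    by apply/funext => m; rewrite big_nil.
  split; first exact: C1M_cst.
  (* For the empty sum, additivity applied to 0 + 0 = 0 forces the value 0. *)
  have := stokes_functionalD hf hH hmu P (C1M_cst (f := f) 0) (C1M_cst (f := f) 0).
  have -> : (fun=> 0 + 0) = (fun=> 0) :> (M -> R) by apply/funext => m; rewrite addr0.
  by move/eqP; rewrite -subr_eq0 opprD addrA subrr sub0r oppr_eq0 => /eqP.
have -> : (fun m => \sum_(p <- p :: s) bump_at P p m * g m) =
    fun m => bump_at P p m * g m + \sum_(p <- s) bump_at P p m * g m.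
  by apply/funext => m; rewrite big_cons.
have cp := C1MM (bump_at_C1M hf P p) cg.
split; first exact: C1MD.
rewrite (stokes_functionalD hf hH hmu P cp cs) IH addr0.
exact: stokes_bump.
Qed.

Lemma stokes_one : stokes (fun=> 1) = 0.
Proof.
have [s cs] := bump_at_cover hf P.
have [crho _] := stokes_sum s (C1M_cst (f := f) 1).
(* The factor 1 keeps [rho] in the form in which [stokes_sum] delivers its regularity. Taking [g] as
   the inverse of [rho] then makes the weighted bumps add up to 1. *)
pose rho m := \sum_(p <- s) bump_at P p m * 1.
have rho0 m : rho m != 0.
  rewrite lt0r_neq0// /rho; have [p ps bp] := cs m.
  rewrite (big_rem p)//= mulr1; apply: ltr_wpDr bp.
  apply: sumr_ge0 => p' _; rewrite mulr1; exact: surface_bump_ge0.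
have [_] := stokes_sum s (C1MV rho0 crho).
suff -> : (fun m => \sum_(p <- s) bump_at P p m * (rho m)^-1) = fun=> 1 by [].
apply/funext => m; rewrite -mulr_suml.
rewrite (_ : \sum_(p <- s) bump_at P p m = rho m) ?divff//.
by apply: eq_bigr => p _; rewrite mulr1.
Qed.

Lemma theta1_alg (h n X Y l : R) : 2 * 1 * h * n + (X * 0 + Y * 0) / l = 2 * (h * n).
Proof. by ring. Qed.

Lemma flux_zero : \int[mu]_(p in [set: borel M]) (H p * normal3 P p) = 0.
Proof.
have E p : Theta H P (fun=> 1) p = 2 * (H p * normal3 P p).
  have D0 v : 'D_v (rep (fun=> 1 : R) (chart_at P p)) (chart_map (chart_at P p) p) = 0.
    exact: derive_cst.
  rewrite /Theta /grad3_at /grad3 !D0; exact: theta1_alg.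
have cH : continuous H := @H_continuous _ _ _ hf _ hH P.
have cn : continuous (normal3 P) := @normal3_continuous _ _ _ hf P.
have cHn : continuous (fun p : M => H p * normal3 P p).
  by move=> p; exact: (continuous_forM (cH p) (cn p)).
have iH := continuous_area_integrable hf hmu P cHn.
have := stokes_one; rewrite /stokes_functional.
have -> : \int[mu]_(p in [set: borel M]) Theta H P (fun=> 1) p =
    \int[mu]_(p in [set: borel M]) (2 * (H p * normal3 P p)).
  by apply: eq_Rintegral => p _; exact: E.
rewrite (RintegralZl _ measurableT iH) => /eqP; rewrite mulf_eq0 pnatr_eq0/= => /eqP; exact.
Qed.

(** [chart_integral] turns each integral over a piece, taken in its own parameter, into one against
    [mu]; the disjoint pieces then add up to M. *)
Lemma sum_pieces (h : M -> R) (k : forall i : 'I_(sp_size P), plane R -> R) : continuous h ->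
  (forall i q, chart_im (ch i) q -> k i q = h (chart_inv (ch i) q) * conformal_factor f (ch i) q) ->
  \sum_i \int[lebesgue2]_(q in (chart_map (ch i) @` sp_piece i : set mplane)) k i q =
  \int[mu]_(p in [set: borel M]) h p.
Proof.
move=> ch_ kE; have ih := continuous_area_integrable hf hmu P ch_.
have mP i : measurable (sp_piece (s := P) i : set (borel M)) by exact: sp_borel.
transitivity (\sum_i \int[mu]_(p in (sp_piece (s := P) i : set (borel M))) h p).
  apply: eq_bigr => i _; rewrite /Rintegral.
  have [_ ->] := chart_integral hf hmu (sp_conformal i) (sp_spinor i) (mP i) (@sp_sub _ _ _ P i)
    (integrableS measurableT (mP i) (@subsetT _ _) ih).
  congr fine; apply: eq_integral => q; rewrite inE => -[p pp <-]; congr EFin; apply: kE.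
  by apply: chart_im_map; exact: sp_sub pp.
have D : [set: borel M] = \big[setU/set0]_(i <- index_enum 'I_(sp_size P))
    (sp_piece (s := P) i : set (borel M)).
  apply/seteqP; split => m // _; rewrite -bigcup_seq.
  have [i pi] := sp_index P m; exists i => //.
  by rewrite /= mem_index_enum.
rewrite /Rintegral D integral_bigsetU_EFin//; last 3 first.
- exact: index_enum_uniq.
- by move=> i j _ _; exact: sp_disjoint.
- by rewrite -D; exact: measurable_int ih.
rewrite -sum_fine//.
move=> i _; apply: integrable_fin_num => //.
exact: integrableS measurableT (mP i) (@subsetT _ _) ih.
Qed.

End Energy.

Theorem proposition5 (R : realType) (M : closed_oriented_surface R)
    (f : M -> 'rV[R]_3) (hf : immersion f)
    (H : M -> R) (hH : is_mean_curvature f H)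
    (Khat : M -> R) (hK : is_tangent_sectional_curvature f Khat)
    (mu : {measure set (borel M) -> \bar R}) (hmu : is_area_measure f mu)
    (P : spinor_partition f) :
  energy H P =
  (4^-1 * \int[mu]_(p in [set: borel M])
             (H p ^+ 2 + Khat p / 4 - 16^-1))%:C.
Proof.
have cH : continuous H := @H_continuous _ _ _ hf _ hH P.
have cn : continuous (normal3 P) := @normal3_continuous _ _ _ hf P.
have KE p : Khat p = 4^-1 - normal3 P p ^+ 2.
  exact: (tangent_curvature hf hK (chart_at_conformal P p) (chart_at_dom P p)).
pose h1 p := (H p ^+ 2 - normal3 P p ^+ 2 / 4) / 4.
pose h2 p := H p * normal3 P p / 4.
have c4 (p : M) : {for p, continuous (fun _ : M => 4^-1 : R)} by exact: cvg_cst.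
have ch2 : continuous h2.
  by move=> p; exact: (continuous_forM (continuous_forM (cH p) (cn p)) (c4 p)).
have cnn p : {for p, continuous (fun p => - (normal3 P p ^+ 2 / 4))}.
  exact: cvgN (continuous_forM (continuous_forM (cn p) (cn p)) (c4 p)).
have cg1 : continuous (fun p => H p ^+ 2 - normal3 P p ^+ 2 / 4).
  by move=> p; exact: (continuous_forD (continuous_forM (cH p) (cH p)) (cnn p)).
have ch1 : continuous h1 by move=> p; exact: (continuous_forM (cg1 p) (c4 p)).
have U (i : 'I_(sp_size P)) q : chart_im (sp_chart i) q ->
  complex.Re (potentialU H (sp_chart i) (sp_psi1 i) (sp_psi2 i) q *
              potentialV H (sp_chart i) (sp_psi1 i) (sp_psi2 i) q) =
    h1 (chart_inv (sp_chart i) q) * conformal_factor f (sp_chart i) q /\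
  complex.Im (potentialU H (sp_chart i) (sp_psi1 i) (sp_psi2 i) q *
              potentialV H (sp_chart i) (sp_psi1 i) (sp_psi2 i) q) =
    h2 (chart_inv (sp_chart i) q) * conformal_factor f (sp_chart i) q.
  move=> cq; have [cp e] := chart_im_inv cq.
  rewrite /h1 /h2 (normal3E hf P (sp_conformal i) cp) e.
  exact: (@potential_sq _ _ _ hf (sp_chart i) (sp_psi1 i) (sp_psi2 i) q
    (H (chart_inv (sp_chart i) q)) (sp_spinor i) (sp_conformal i) cq).
have iG := continuous_area_integrable hf hmu P cg1.
have cHn : continuous (fun p : M => H p * normal3 P p).
  by move=> p; exact: (continuous_forM (cH p) (cn p)).
have iF := continuous_area_integrable hf hmu P cHn.
apply: eq_complexP; rewrite ?cReC ?cImC /energy.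
  rewrite (big_morph (@complex.Re R) (@cReD R) erefl).
  apply: etrans (sum_pieces hf hmu ch1 (fun i q cq => (U i q cq).1)) _.
  (* The constants come from Khat = 1/4 - n_3^2, so that Khat / 4 - 1/16 = - n_3^2 / 4. *)
  have -> : \int[mu]_(p in [set: borel M]) (H p ^+ 2 + Khat p / 4 - 16^-1) =
      \int[mu]_(p in [set: borel M]) (H p ^+ 2 - normal3 P p ^+ 2 / 4).
    by apply: eq_Rintegral => p _; rewrite KE; field.
  rewrite -(RintegralZl _ measurableT iG).
  by apply: eq_Rintegral => p _; rewrite /h1 mulrC.
(* The imaginary part is a quarter of the integral of H n_3, which is 0 by [flux_zero]. *)
rewrite (big_morph (@complex.Im R) (@cImD R) erefl).
apply: etrans (sum_pieces hf hmu ch2 (fun i q cq => (U i q cq).2)) _.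
have -> : \int[mu]_(p in [set: borel M]) h2 p =
    \int[mu]_(p in [set: borel M]) (4^-1 * (H p * normal3 P p)).
  by apply: eq_Rintegral => p _; rewrite /h2 mulrC.
by rewrite (RintegralZl _ measurableT iF) (flux_zero hf hH hmu P) mulr0.
Qed.
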